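(* Let $\mathcal M$ be a triangulated category that is a module over a tensor triangulated category $(\mathcal K,\otimes,1)$. Let $\mathfrak F=\{\mathcal F_i\}_{i\in I}$ be a family of thick $\mathcal K$-submodules of $\mathcal M$ such that $\mathcal M\in\mathfrak F$. Then the following statements are equivalent: (1) The family $\mathfrak F$ satisfies the following two conditions: (a) given any non-empty subset $J\subseteq I$, we have $\bigcap_{j\in J}\mathcal F_j\in\mathfrak F$; (b) if $\{\mathcal F_k\}_{k\in K}$ is a filtered directed collection of members of $\mathfrak F$, then the filtered directed union $\bigcup_{k\in K}\mathcal F_k$ also lies in $\mathfrak F$. (2) There exists a closure operator $c:SMod(\mathcal M)\longrightarrow SMod(\mathcal M)$ of finite type such that $\mathfrak F$ is the collection of fixed points of $c$. In particular, when (2) holds, $\mathfrak F$ (with the subspace topology from $SMod(\mathcal M)$) is a spectral space with $\{U(m)\cap\mathfrak F\}_{m\in\mathcal M}$ being a basis of quasi-compact open sets, where $U(m)=\{\mathcal N\in SMod(\mathcal M) : m\in\mathcal N\}$.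
   Context: All categories are assumed to be essentially small. A tensor triangulated category $(\mathcal K,\otimes,1)$ is a triangulated category $\mathcal K$ with a symmetric monoidal product $\otimes:\mathcal K\times\mathcal K\to\mathcal K$ that is exact in each variable, with unit object $1$. A triangulated category $\mathcal M$ is a module over $(\mathcal K,\otimes,1)$ (in the sense of Stevenson) if there is a functor (action) $\ast:\mathcal K\times\mathcal M\to\mathcal M$, exact in each variable, together with natural isomorphisms $(a\otimes b)\ast m\cong a\ast(b\ast m)$ and $1\ast m\cong m$ satisfying the usual pentagon and unit coherence conditions, compatible with exactness and with the translation functors $T_{\mathcal K}$, $T_{\mathcal M}$ (in particular $T_{\mathcal K}(a)\ast m\cong T_{\mathcal M}(a\ast m)\cong a\ast T_{\mathcal M}(m)$, with the usual sign $(-1)^{rs}$ in the comparison $T_{\mathcal K}^r(1)\ast T_{\mathcal M}^s(m)\cong T_{\mathcal M}^{r+s}(m)$), and distributing over coproducts whenever they exist. A thick $\mathcal K$-submodule of $\mathcal M$ is a full subcategory $\mathcal L\subseteq\mathcal M$ containing $0$ such that: (a) $a\ast m\in\mathcal L$ for all $a\in\mathcal K$, $m\in\mathcal L$; (b) for $m,m'\in\mathcal M$, $m\oplus m'\in\mathcal L$ if and only if both $m,m'\in\mathcal L$; (c) for any distinguished triangle $m'\to m\to m''$ in $\mathcal M$, if two of $m',m,m''$ lie in $\mathcal L$, so does the third. A submodule is thus determined by its objects (and is closed under isomorphism); inclusions, unions and intersections refer to objects. The collection $SMod(\mathcal M)$ of all thick $\mathcal K$-submodules is a set; it is given the topology having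 the sets $U(m)$, $m\in\mathcal M$, as a subbasis of open sets. For $m\in\mathcal M$, $\mathcal K(m)$ denotes the smallest thick $\mathcal K$-submodule containing $m$. A closure operator on $SMod(\mathcal M)$ is a map $c:SMod(\mathcal M)\to SMod(\mathcal M)$ that is extensive ($\mathcal N\subseteq c(\mathcal N)$ for each $\mathcal N$), order-preserving ($\mathcal N\subseteq\mathcal N'$ implies $c(\mathcal N)\subseteq c(\mathcal N')$) and idempotent ($c(c(\mathcal N))=c(\mathcal N)$ for each $\mathcal N$). It is of finite type if moreover $c(\mathcal N)=\bigcup_{n\in\mathcal N}c(\mathcal K(n))$ for each $\mathcal N$. A filtered directed collection is a non-empty collection in which any two members are contained in a third member. A spectral space is a topological space homeomorphic to the Zariski spectrum of a commutative ring. *)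

(* Defs.v *)
(* MathComp / MathComp-Analysis *)
From HB Require Import structures.
From mathcomp Require Import all_boot all_order all_algebra.
From mathcomp Require Import all_classical.
From mathcomp Require Import topology.

Set Implicit Arguments.
Unset Strict Implicit.
Unset Printing Implicit Defensive.

Import GRing.Theory.

Local Open Scope classical_set_scope.
Local Open Scope ring_scope.

Reserved Notation "g \oc f" (at level 40, left associativity).

(** ** Additive categories *)

(* [hom a b] carries a choice structure through [zmodType]; classically this
   is no restriction. *)
Record preadditive := Preadditive {
  obj :> Type;
  hom : obj -> obj -> zmodType;
  idm : forall a, hom a a;
  mcomp : forall a b c, hom b c -> hom a b -> hom a c;
  comp1m : forall a b (f : hom a b), mcomp (idm b) f = f;
  compm1 : forall a b (f : hom a b), mcomp f (idm a) = f;
  compA : forall a b c d (h : hom c d) (g : hom b c) (f : hom a b),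
    mcomp h (mcomp g f) = mcomp (mcomp h g) f;
  compDl : forall a b c (g g' : hom b c) (f : hom a b),
    mcomp (g + g') f = mcomp g f + mcomp g' f;
  compDr : forall a b c (g : hom b c) (f f' : hom a b),
    mcomp g (f + f') = mcomp g f + mcomp g f'
}.

Arguments hom {_} _ _.
Arguments idm {_} _.
Arguments mcomp {_ _ _ _} _ _.
Notation "g \oc f" := (mcomp g f) : ring_scope.

Section Preadditive.
Variable C : preadditive.
Implicit Types a b c z s : C.

Definition is_iso a b (f : hom a b) : Prop :=
  exists g : hom b a, g \oc f = idm a /\ f \oc g = idm b.

Record iso a b := Iso {
  isof :> hom a b;
  isoV : hom b a;
  isoK : isoV \oc isof = idm a;
  isoVK : isof \oc isoV = idm b
}.

Definition iso_id a : iso a a := Iso (comp1m (idm a)) (comp1m (idm a)).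

Definition iso_inv a b (f : iso a b) : iso b a := Iso (isoVK f) (isoK f).

Definition iso_comp a b c (g : iso b c) (f : iso a b) : iso a c.
Proof.
exists (g \oc f) (isoV f \oc isoV g).
- by rewrite compA -(compA _ (isoV g)) isoK compm1 isoK.
- by rewrite compA -(compA _ f) isoVK compm1 isoVK.
Defined.

(* Existence of the morphisms is automatic, hom-groups being inhabited. *)
Definition is_zero z : Prop :=
  forall a, (forall f g : hom z a, f = g) /\ (forall f g : hom a z, f = g).

Definition is_dsum a b s : Prop :=
  exists (i1 : hom a s) (i2 : hom b s) (p1 : hom s a) (p2 : hom s b),
    [/\ p1 \oc i1 = idm a, p2 \oc i2 = idm b, p1 \oc i2 = 0, p2 \oc i1 = 0
      & i1 \oc p1 + i2 \oc p2 = idm s].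

Definition is_coproduct (I : Type) (x : I -> C) c (inj : forall i, hom (x i) c)
    : Prop :=
  forall a (f : forall i, hom (x i) a),
    exists! u : hom c a, forall i, u \oc inj i = f i.

End Preadditive.

Record addfun (C D : preadditive) := Addfun {
  fobj :> C -> D;
  fmor : forall a b, hom a b -> hom (fobj a) (fobj b);
  fmap1 : forall a, fmor (idm a) = idm (fobj a);
  fmapM : forall a b c (g : hom b c) (f : hom a b),
    fmor (g \oc f) = fmor g \oc fmor f;
  fmapD : forall a b (f g : hom a b), fmor (f + g) = fmor f + fmor g
}.

Arguments fmor {C D} _ {a b} _.

Section Functors.

Definition fun_id (C : preadditive) : addfun C C :=
  @Addfun C C (fun a => a) (fun _ _ f => f)
    (fun _ => erefl) (fun _ _ _ _ _ => erefl) (fun _ _ _ _ => erefl).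

Definition fun_comp (C D E : preadditive) (G : addfun D E) (F : addfun C D) :
  addfun C E.
Proof.
exists (fun a => G (F a)) (fun a b f => fmor G (fmor F f)).
- by move=> a; rewrite !fmap1.
- by move=> a b c g f; rewrite !fmapM.
- by move=> a b f g; rewrite !fmapD.
Defined.

Fixpoint fun_pow (C : preadditive) (F : addfun C C) (n : nat) : addfun C C :=
  if n is n'.+1 then fun_comp F (fun_pow F n') else fun_id C.

Definition iso_map (C D : preadditive) (F : addfun C D) (a b : C)
  (f : iso a b) : iso (F a) (F b).
Proof.
exists (fmor F f) (fmor F (isoV f)).
- by rewrite -fmapM isoK fmap1.
- by rewrite -fmapM isoVK fmap1.
Defined.

(* From [F S ~ S' F] to [F S^n ~ S'^n F]. *)
Fixpoint comm_pow (C D : preadditive) (F : addfun C D) (S : addfun C C)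
    (S' : addfun D D) (phi : forall x, iso (F (S x)) (S' (F x)))
    (n : nat) (x : C) : iso (F (fun_pow S n x)) (fun_pow S' n (F x)) :=
  if n is n'.+1 then
    iso_comp (iso_map S' (comm_pow phi n' x)) (phi (fun_pow S n' x))
  else iso_id (F x).

(* From [S T ~ T S] to [S^n T ~ T S^n]. *)
Fixpoint pow_comm (C : preadditive) (S T : addfun C C)
    (phi : forall x, iso (S (T x)) (T (S x)))
    (n : nat) (x : C) : iso (fun_pow S n (T x)) (T (fun_pow S n x)) :=
  if n is n'.+1 then
    iso_comp (phi (fun_pow S n' x)) (iso_map S (pow_comm phi n' x))
  else iso_id (T x).

End Functors.

(** ** Categories with translation *)

(* The translation is an autoequivalence [T], with its quasi-inverse [T']
   normalised to an adjoint equivalence. A strict automorphism is the case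
   where [T_unit] and [T_counit] are identities. *)
Record transcat := Transcat {
  trans_base :> preadditive;
  T : addfun trans_base trans_base;
  T' : addfun trans_base trans_base;
  T_unit : forall x, iso x (T' (T x));
  T_counit : forall x, iso (T (T' x)) x;
  T_unit_nat : forall x y (f : hom x y),
    T_unit y \oc f = fmor T' (fmor T f) \oc T_unit x;
  T_counit_nat : forall x y (f : hom x y),
    T_counit y \oc fmor T (fmor T' f) = f \oc T_counit x;
  T_zigzag : forall x, T_counit (T x) \oc fmor T (T_unit x) = idm (T x);
  T'_zigzag : forall x, fmor T' (T_counit x) \oc T_unit (T' x) = idm (T' x)
}.

Arguments T {_}.
Arguments T' {_}.
Arguments T_unit {_} _.
Arguments T_counit {_} _.

Section Translation.

Definition Tpow (C : transcat) (r : int) : addfun C C :=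
  match r with
  | Posz n => fun_pow T n
  | Negz n => fun_pow T' n.+1
  end.

Section Comm.
Variables (C D : transcat) (F : addfun C D).
Variable phi : forall x, iso (F (T x)) (T (F x)).

Definition comm_T' (x : C) : iso (F (T' x)) (T' (F x)) :=
  iso_comp (iso_map T' (iso_map F (T_counit x)))
    (iso_comp (iso_map T' (iso_inv (phi (T' x)))) (T_unit (F (T' x)))).

Definition comm_Tpow (r : int) (x : C) : iso (F (Tpow C r x)) (Tpow D r (F x)) :=
  match r with
  | Posz n => comm_pow phi n x
  | Negz n => comm_pow comm_T' n.+1 x
  end.

End Comm.

Definition TT_comm (C : transcat) (x : C) : iso (T (T x)) (T (T x)) :=
  iso_id (T (T x)).

Definition T'T_comm (C : transcat) (x : C) : iso (T' (T x)) (T (T' x)) :=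
  iso_comp (iso_inv (T_counit x)) (iso_inv (T_unit x)).

Definition Tpow_T (C : transcat) (r : int) (x : C) :
    iso (Tpow C r (T x)) (T (Tpow C r x)) :=
  match r with
  | Posz n => pow_comm (@TT_comm C) n x
  | Negz n => pow_comm (@T'T_comm C) n.+1 x
  end.

(* The identification of [T^r T^s] with [T^s T^r] through [T^(r+s)]: it is built
   from the identity of [T T], the unit and the counit, without signs. *)
Definition Tpow_swap (C : transcat) (r s : int) (x : C) :
    iso (Tpow C r (Tpow C s x)) (Tpow C s (Tpow C r x)) :=
  comm_Tpow (Tpow_T r) s x.

End Translation.

(** ** Triangulated categories *)

(* [dist f g h] : the triangle x --f--> y --g--> z --h--> T x is
   distinguished. *)
Record tricat := Tricat {
  tri_base :> transcat;
  tri_zero : exists z : tri_base, is_zero z;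
  tri_dsum : forall a b : tri_base, exists s, is_dsum a b s;
  dist : forall x y z : tri_base, hom x y -> hom y z -> hom z (T x) -> Prop;
  dist_iso : forall (x y z x' y' z' : tri_base)
      (f : hom x y) (g : hom y z) (h : hom z (T x))
      (f' : hom x' y') (g' : hom y' z') (h' : hom z' (T x'))
      (u : iso x x') (v : iso y y') (w : iso z z'),
    v \oc f = f' \oc u -> w \oc g = g' \oc v -> fmor T u \oc h = h' \oc w ->
    dist f g h -> dist f' g' h';
  dist_id : forall x z : tri_base, is_zero z ->
    dist (idm x) (0 : hom x z) (0 : hom z (T x));
  dist_cone : forall (x y : tri_base) (f : hom x y),
    exists (z : tri_base) (g : hom y z) (h : hom z (T x)), dist f g h;
  dist_rot : forall (x y z : tri_base)
      (f : hom x y) (g : hom y z) (h : hom z (T x)),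
    dist f g h <-> dist g h (- fmor T f);
  dist_fill : forall (x y z x' y' z' : tri_base)
      (f : hom x y) (g : hom y z) (h : hom z (T x))
      (f' : hom x' y') (g' : hom y' z') (h' : hom z' (T x'))
      (u : hom x x') (v : hom y y'),
    dist f g h -> dist f' g' h' -> v \oc f = f' \oc u ->
    exists w : hom z z', w \oc g = g' \oc v /\ fmor T u \oc h = h' \oc w;
  dist_octahedron : forall (x y z u v w : tri_base)
      (f : hom x y) (g : hom y z)
      (i : hom y u) (d : hom u (T x))
      (i' : hom z w) (d' : hom w (T y))
      (i'' : hom z v) (d'' : hom v (T x)),
    dist f i d -> dist g i' d' -> dist (g \oc f) i'' d'' ->
    exists (p : hom u v) (q : hom v w),
      dist p q (fmor T i \oc d') /\
      [/\ p \oc i = i'' \oc g, d'' \oc p = d, q \oc i'' = i'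
        & d' \oc q = fmor T f \oc d'']
}.

Arguments dist {_ _ _ _} _ _ _.

Definition preserves_dist (C D : tricat) (F : addfun C D)
    (phi : forall x, iso (F (T x)) (T (F x))) : Prop :=
  forall (x y z : C) (f : hom x y) (g : hom y z) (h : hom z (T x)),
    dist f g h -> dist (fmor F f) (fmor F g) (phi x \oc fmor F h).

(** ** Biexact functors *)

Record bifun (C D E : preadditive) := Bifun {
  bobj :> C -> D -> E;
  bmap : forall a a' b b', hom a a' -> hom b b' -> hom (bobj a b) (bobj a' b');
  bmap1 : forall a b, bmap (idm a) (idm b) = idm (bobj a b);
  bmapM : forall a a' a'' b b' b'' (f' : hom a' a'') (f : hom a a')
      (g' : hom b' b'') (g : hom b b'),
    bmap (f' \oc f) (g' \oc g) = bmap f' g' \oc bmap f g;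
  bmapDl : forall a a' b b' (f f' : hom a a') (g : hom b b'),
    bmap (f + f') g = bmap f g + bmap f' g;
  bmapDr : forall a a' b b' (f : hom a a') (g g' : hom b b'),
    bmap f (g + g') = bmap f g + bmap f g'
}.

Arguments bmap {C D E} _ {a a' b b'} _ _.

Definition bfun1 (C D E : preadditive) (B : bifun C D E) (b : D) : addfun C E.
Proof.
exists (fun a => B a b) (fun a a' f => bmap B f (idm b)).
- by move=> a; rewrite bmap1.
- by move=> a a' a'' f' f; rewrite -bmapM comp1m.
- by move=> a a' f f'; rewrite bmapDl.
Defined.

Definition bfun2 (C D E : preadditive) (B : bifun C D E) (a : C) : addfun D E.
Proof.
exists (fun b => B a b) (fun b b' g => bmap B (idm a) g).
- by move=> b; rewrite bmap1.
- by move=> b b' b'' g' g; rewrite -bmapM comp1m.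
- by move=> b b' g g'; rewrite bmapDr.
Defined.

Record biexact (C D E : tricat) := Biexact {
  bx_fun :> bifun C D E;
  bx_T1 : forall a b, iso (bx_fun (T a) b) (T (bx_fun a b));
  bx_T2 : forall a b, iso (bx_fun a (T b)) (T (bx_fun a b));
  bx_T1_nat : forall a a' b b' (f : hom a a') (g : hom b b'),
    bx_T1 a' b' \oc bmap bx_fun (fmor T f) g
    = fmor T (bmap bx_fun f g) \oc bx_T1 a b;
  bx_T2_nat : forall a a' b b' (f : hom a a') (g : hom b b'),
    bx_T2 a' b' \oc bmap bx_fun f (fmor T g)
    = fmor T (bmap bx_fun f g) \oc bx_T2 a b;
  bx_exact1 : forall b,
    @preserves_dist C E (bfun1 bx_fun b) (fun a => bx_T1 a b);
  bx_exact2 : forall a,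
    @preserves_dist D E (bfun2 bx_fun a) (fun b => bx_T2 a b)
}.

(** ** Tensor triangulated categories and their modules *)

Record ttcat := Ttcat {
  tt_base :> tricat;
  tens : biexact tt_base tt_base tt_base;
  tone : tt_base;
  tens_assoc : forall a b c, iso (tens (tens a b) c) (tens a (tens b c));
  tens_unitl : forall a, iso (tens tone a) a;
  tens_unitr : forall a, iso (tens a tone) a;
  tens_sym : forall a b, iso (tens a b) (tens b a);
  tens_assoc_nat : forall a a' b b' c c'
      (f : hom a a') (g : hom b b') (h : hom c c'),
    tens_assoc a' b' c' \oc bmap tens (bmap tens f g) h
    = bmap tens f (bmap tens g h) \oc tens_assoc a b c;
  tens_unitl_nat : forall a b (f : hom a b),
    tens_unitl b \oc bmap tens (idm tone) f = f \oc tens_unitl a;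
  tens_unitr_nat : forall a b (f : hom a b),
    tens_unitr b \oc bmap tens f (idm tone) = f \oc tens_unitr a;
  tens_sym_nat : forall a a' b b' (f : hom a a') (g : hom b b'),
    tens_sym a' b' \oc bmap tens f g = bmap tens g f \oc tens_sym a b;
  tens_pentagon : forall a b c d,
    tens_assoc a b (tens c d) \oc tens_assoc (tens a b) c d
    = bmap tens (idm a) (tens_assoc b c d)
      \oc tens_assoc a (tens b c) d
      \oc bmap tens (tens_assoc a b c) (idm d);
  tens_triangle : forall a b,
    bmap tens (idm a) (tens_unitl b) \oc tens_assoc a tone b
    = bmap tens (tens_unitr a) (idm b);
  tens_hexagon : forall a b c,
    tens_assoc b c a \oc tens_sym a (tens b c) \oc tens_assoc a b c
    = bmap tens (idm b) (tens_sym a c)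
      \oc tens_assoc b a c
      \oc bmap tens (tens_sym a b) (idm c);
  tens_symK : forall a b, tens_sym b a \oc tens_sym a b = idm (tens a b)
}.

Arguments tens {_}.
Arguments tone {_}.
Arguments tens_assoc {_} _ _ _.
Arguments tens_unitl {_} _.
Arguments tens_unitr {_} _.

Record ttmodule (K : ttcat) := Ttmodule {
  mod_base :> tricat;
  act : biexact K mod_base mod_base;
  act_assoc : forall (a b : K) (m : mod_base),
    iso (act (tens a b) m) (act a (act b m));
  act_unit : forall m : mod_base, iso (act tone m) m;
  act_assoc_nat : forall (a a' b b' : K) (m m' : mod_base)
      (f : hom a a') (g : hom b b') (h : hom m m'),
    act_assoc a' b' m' \oc bmap act (bmap tens f g) h
    = bmap act f (bmap act g h) \oc act_assoc a b m;
  act_unit_nat : forall (m m' : mod_base) (f : hom m m'),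
    act_unit m' \oc bmap act (idm tone) f = f \oc act_unit m;
  act_pentagon : forall (a b c : K) (m : mod_base),
    act_assoc a b (act c m) \oc act_assoc (tens a b) c m
    = bmap act (idm a) (act_assoc b c m)
      \oc act_assoc a (tens b c) m
      \oc bmap act (tens_assoc a b c) (idm m);
  act_unitr_coh : forall (a : K) (m : mod_base),
    bmap act (idm a) (act_unit m) \oc act_assoc a tone m
    = bmap act (tens_unitr a) (idm m);
  act_unitl_coh : forall (a : K) (m : mod_base),
    act_unit (act a m) \oc act_assoc tone a m
    = bmap act (tens_unitl a) (idm m);
  (* the unitor and the associator commute with the exactness isomorphisms, in
     each variable *)
  act_unit_T : forall m : mod_base,
    fmor T (act_unit m) \oc bx_T2 act tone m = act_unit (T m);
  act_assoc_T1 : forall (a b : K) (m : mod_base),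
    fmor T (act_assoc a b m)
      \oc bx_T1 act (tens a b) m
      \oc bmap act (bx_T1 tens a b) (idm m)
    = bx_T1 act a (act b m) \oc act_assoc (T a) b m;
  act_assoc_T2 : forall (a b : K) (m : mod_base),
    fmor T (act_assoc a b m)
      \oc bx_T1 act (tens a b) m
      \oc bmap act (bx_T2 tens a b) (idm m)
    = bx_T2 act a (act b m)
      \oc bmap act (idm a) (bx_T1 act b m)
      \oc act_assoc a (T b) m;
  act_assoc_T3 : forall (a b : K) (m : mod_base),
    fmor T (act_assoc a b m) \oc bx_T2 act (tens a b) m
    = bx_T2 act a (act b m)
      \oc bmap act (idm a) (bx_T2 act b m)
      \oc act_assoc a b (T m);
  (* Both sides go from T^r(1) * T^s(m) to T^r(T^s(m)); the left-hand side takes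
     T^s out first, the right-hand side T^r. *)
  act_sign : forall (r s : int) (m : mod_base),
    Tpow_swap s r m
      \oc fmor (Tpow _ s) (fmor (Tpow _ r) (act_unit m))
      \oc fmor (Tpow _ s)
            (comm_Tpow (F := bfun1 act m) (fun a => bx_T1 act a m) r tone)
      \oc comm_Tpow (F := bfun2 act (Tpow K r tone))
            (bx_T2 act (Tpow K r tone)) s m
    = (fmor (Tpow _ r) (act_unit (Tpow _ s m))
      \oc comm_Tpow (F := bfun1 act (Tpow _ s m))
            (fun a => bx_T1 act a (Tpow _ s m)) r tone)
      *~ ((-1) ^ (r * s));
  act_coprod1 : forall (I : Type) (x : I -> K) (c : K)
      (inj : forall i, hom (x i) c) (m d : mod_base)
      (inj' : forall i, hom (act (x i) m) d) (u : hom d (act c m)),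
    is_coproduct inj -> is_coproduct inj' ->
    (forall i, u \oc inj' i = bmap act (inj i) (idm m)) -> is_iso u;
  act_coprod2 : forall (I : Type) (x : I -> mod_base) (c : mod_base)
      (inj : forall i, hom (x i) c) (a : K) (d : mod_base)
      (inj' : forall i, hom (act a (x i)) d) (u : hom d (act a c)),
    is_coproduct inj -> is_coproduct inj' ->
    (forall i, u \oc inj' i = bmap act (idm a) (inj i)) -> is_iso u
}.

Arguments act {K _}.

(** ** Thick submodules *)

(* Direct sums and zero objects are only determined up to isomorphism, so the
   conditions quantify over all of them; closure under isomorphism follows. *)
Record thick_submodule (K : ttcat) (M : ttmodule K) (L : set M) : Prop := {
  thick_zero : forall z : M, is_zero z -> L z;
  thick_act : forall (a : K) (m : M), L m -> L (act a m);
  thick_dsum : forall m m' s : M, is_dsum m m' s -> (L s <-> L m /\ L m');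
  thick_dist : forall (m' m m'' : M)
      (f : hom m' m) (g : hom m m'') (h : hom m'' (T m')),
    dist f g h ->
    [/\ L m' -> L m -> L m'', L m -> L m'' -> L m' & L m' -> L m'' -> L m]
}.

Record SMod (K : ttcat) (M : ttmodule K) := mkSMod {
  smod_obj :> set M;
  smod_thick : thick_submodule smod_obj
}.

Section SMod.
Variables (K : ttcat) (M : ttmodule K).

Lemma thick_setT : thick_submodule [set: M].
Proof. by split=> //= *; split. Qed.

Definition smod_full : SMod M := mkSMod thick_setT.

Lemma thick_smallest (X : set M) :
  thick_submodule (smallest (@thick_submodule K M) X).
Proof.
split.
- by move=> z z0 L [tL _]; apply: thick_zero.
- by move=> a m Lm L [tL XL]; apply: thick_act => //; apply: Lm.
- move=> m m' s sP; split=> [Ls|[Lm Lm'] L LP].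
    by split=> L LP; have [tL _] := LP;
       have [/(_ (Ls L LP))[]] := thick_dsum tL sP.
  have [tL _] := LP.
  by apply/(thick_dsum tL sP); split; [exact: Lm|exact: Lm'].
- move=> m' m m'' f g h fgh; split=> L1 L2 L LP; have [tL _] := LP;
    have [H1 H2 H3] := thick_dist tL fgh;
    have := L1 L LP; have := L2 L LP; tauto.
Qed.

Definition smod_gen (m : M) : SMod M := mkSMod (thick_smallest [set m]).

Definition Uopen (m : M) : set (SMod M) := [set N : SMod M | (N : set M) m].

HB.instance Definition _ := gen_eqMixin (SMod M).
HB.instance Definition _ := gen_choiceMixin (SMod M).
HB.instance Definition _ :=
  @isSubBaseTopological.Build (SMod M) (set (SMod M)) (range Uopen) id.

(* [Uopen m] intersected with [A], as a subset of the subspace [A]. *)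
Definition Usub (A : set (SMod M)) (m : M) : set (set_type A) :=
  set_val @^-1` Uopen m.

Definition closure_operator (c : SMod M -> SMod M) : Prop :=
  [/\ forall N : SMod M, N `<=` c N,
      forall N N' : SMod M, N `<=` N' -> c N `<=` c N'
    & forall N : SMod M, c (c N) = c N].

Definition finite_type (c : SMod M -> SMod M) : Prop :=
  forall N : SMod M,
    c N = \bigcup_(n in (N : set M)) (c (smod_gen n) : set M) :> set M.

Definition filtered_directed (D : set (SMod M)) : Prop :=
  D !=set0 /\
  forall N N' : SMod M, D N -> D N' ->
    exists P : SMod M, [/\ D P, N `<=` P & N' `<=` P].

End SMod.

Arguments Usub {K M} A m.

(** ** Spectral spaces *)

(* MathComp's [prime_idealr] requires a nonzero ring, which would exclude the
   empty spectrum. *)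
Record prime_ideal (R : comPzRingType) (P : set R) : Prop := {
  prime0 : P 0;
  primeD : forall x y, P x -> P y -> P (x + y);
  primeMl : forall a x, P x -> P (a * x);
  prime1 : ~ P 1;
  primeM : forall x y, P (x * y) -> P x \/ P y
}.

Record Spec (R : comPzRingType) := mkSpec {
  spec_set :> set R;
  spec_prime : prime_ideal spec_set
}.

Section Spec.
Variable R : comPzRingType.

Definition zariski_closed (S : set R) : set (Spec R) :=
  [set P : Spec R | S `<=` P].

Definition zariski_open : set (set (Spec R)) :=
  [set ~` zariski_closed S | S in [set: set R]].

Lemma zariski_openT : zariski_open setT.
Proof.
exists [set 1] => //; rewrite -subTset => P _ /(_ 1 erefl).
exact: prime1 (spec_prime P).
Qed.

Lemma zariski_openI : setI_closed zariski_open.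
Proof.
move=> _ _ [S _ <-] [S' _ <-].
exists [set x * y | x in S & y in S'] => //.
rewrite -setCU; congr (~` _); apply/seteqP; split=> P.
- move=> SS'P; have [SP|] := pselect (S `<=` P); first by left.
  move=> /existsNP[x /not_implyP[Sx nPx]]; right=> y S'y.
  have : (P : set R) (x * y) by apply: SS'P; exists x => //; exists y.
  by case/(primeM (spec_prime P)).
- case=> SP _ [x Sx [y S'y <-]]; first rewrite mulrC.
    by apply: (primeMl (spec_prime P)); exact: SP.
  by apply: (primeMl (spec_prime P)); exact: SP.
Qed.

Lemma zariski_open_bigU (J : Type) (f : J -> set (Spec R)) :
  (forall i, zariski_open (f i)) -> zariski_open (\bigcup_i f i).
Proof.
move=> fo; have /choice[S SE] : forall i, exists S, ~` zariski_closed S = f i.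
  by move=> i; have [S _ <-] := fo i; exists S.
exists (\bigcup_i S i) => //; rewrite -[RHS]setCK setC_bigcup; congr (~` _).
apply/seteqP; split=> P.
- by move=> SP i _; rewrite -SE setCK => x Sx; apply: SP; exists i.
- move=> SP x [i _ Six]; have := SP i I.
  by rewrite -SE setCK; apply.
Qed.

HB.instance Definition _ := gen_eqMixin (Spec R).
HB.instance Definition _ := gen_choiceMixin (Spec R).
HB.instance Definition _ := isOpenTopological.Build (Spec R)
  zariski_openT zariski_openI zariski_open_bigU.

End Spec.

Definition homeomorphic (X Y : topologicalType) : Prop :=
  exists (f : X -> Y) (g : Y -> X),
    [/\ cancel f g, cancel g f, continuous f & continuous g].

Definition spectral_space (X : topologicalType) : Prop :=
  exists R : comPzRingType, homeomorphic X (Spec R).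

(* Main.v *)
Require Import Defs.
From HB Require Import structures.
From mathcomp Require Import all_boot all_order all_algebra.
From mathcomp Require Import finmap ring.
From mathcomp.multinomials Require Import monalg.
From mathcomp Require Import all_classical.
From mathcomp Require Import topology.

(** The equivalence is formal: the operator attached to a family sends [N] to the
    intersection of the members containing [N], and finiteness comes from direct
    sums, which make [{c (K(n)) | n in N}] directed.

    For spectrality, the points are the closed sets [y] of a finitary closure
    operator on a set [T], with opens generated by [{y | i in y}]. Following
    Hochster, we realise this space as the spectrum of a ring of functions. Let [K]
    be the fraction field of [Z[t_i | i in T]], let [K_y] be the subfield generated
    by the [t_i] with [i] in [y], and let [m_y] be the maximal ideal of the valuation
    of order in the [t_i] with [i] outside [y]. Take the families [r_y] in [K_y] that
    depend on finitely many coordinates of [y] and satisfy [r_y - r_z] in [m_z] for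
    [z] included in [y]. It contains [x_i], equal to [t_i] where [i] is in [y] and to
    [0] elsewhere. Since the order of a fixed fraction is bounded uniformly in [y],
    [b] divides a power of [a] as soon as [a] vanishes wherever [b] does. A prime [P]
    is therefore determined by [{i | x_i notin P}], which is closed. *)

Set Implicit Arguments.
Unset Strict Implicit.
Unset Printing Implicit Defensive.

Import GRing.Theory Num.Theory.
Local Open Scope classical_set_scope.
Local Open Scope ring_scope.

(** * Integer polynomials in arbitrarily many variables *)

Section Weights.
Variable T : choiceType.
Implicit Types (m : {cmonom T}) (w : T -> nat).

Definition wt w m : nat := (\sum_(i <- finsupp m) m i * w i)%N.

Lemma wtEw w m (d : {fset T}) : (finsupp m `<=` d)%fset ->
  wt w m = (\sum_(i <- d) m i * w i)%N.
Proof.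
move=> le; rewrite /wt (big_fset_incl _ le) // => i _.
by rewrite -cmE_neq0 negbK => /eqP ->.
Qed.

Lemma wt1 w : wt w mone = 0%N.
Proof. by rewrite /wt mdom1 big_seq_fset0. Qed.

Lemma wtU w i : wt w (ucm i) = w i.
Proof. by rewrite /wt mdomU big_seq_fset1 cmUU mul1n. Qed.

Lemma wtM w : {morph wt w : m1 m2 / mmul m1 m2 >-> (m1 + m2)%N}.
Proof.
move=> m1 m2 /=; rewrite {1}/wt mdomD.
rewrite (wtEw w (fsubsetUl _ (finsupp m2))) (wtEw w (fsubsetUr (finsupp m1) _)).
by rewrite -big_split /=; apply/eq_bigr => i _; rewrite cmM mulnDl.
Qed.

Lemma leq_wt_mdeg w m : (forall i, w i <= 1)%N -> (wt w m <= mdeg m)%N.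
Proof.
by move=> w1; apply: leq_sum => i _; rewrite -[leqRHS]muln1 leq_mul.
Qed.

(** When a variable [a] is added, the old weights are multiplied by a strict bound [B] on the
    exponents of [a] in [A], and [a] gets weight 1. The new weighted degree then has the exponent of
    [a] as its remainder modulo [B] and the old weighted degree as its quotient. *)
Lemma separating_weight_seq (A : {fset {cmonom T}}) (s : seq T) : uniq s ->
  exists w, forall m m', m \in A -> m' \in A ->
    (\sum_(i <- s) m i * w i = \sum_(i <- s) m' i * w i)%N ->
    {in s, m =1 m'}.
Proof.
elim: s => [_|a s IH /= /andP[as_ us]]; first by exists (fun=> 0%N).
have [w wP] := IH us.
pose B := (\max_(m <- A) (m a).+1)%N.
have ltB m : m \in A -> (m a < B)%N.
  by move=> mA; rewrite /B (big_fsetD1 m) //= leq_max leqnn.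
pose w' i := if i == a then 1%N else (B * w i)%N.
have w'E m : (\sum_(i <- a :: s) m i * w' i =
    (\sum_(i <- s) m i * w i) * B + m a)%N.
  rewrite big_cons /w' eqxx muln1 addnC big_distrl /=; congr addn.
  rewrite !big_seq; apply: eq_bigr => i is_; case: eqP => [ia|_].
    by rewrite -ia is_ in as_.
  by rewrite mulnAC mulnA.
exists w' => m m' mA m'A; rewrite !w'E => e.
have B0 : (0 < B)%N by apply: leq_ltn_trans (ltB _ mA).
have ea : m a = m' a.
  by have := congr1 (modn^~ B) e; rewrite !modnMDl !modn_small ?ltB.
have es := congr1 (divn^~ B) e.
rewrite !divnMDl // !divn_small ?ltB // !addn0 in es.
by move=> i; rewrite inE => /orP[/eqP->//|]; apply: wP.
Qed.

Lemma separating_weight (A : {fset {cmonom T}}) :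
  exists w, {in A &, injective (wt w)}.
Proof.
pose d := (\bigcup_(m <- A) finsupp m)%fset.
have [w wP] := separating_weight_seq A (fset_uniq d).
exists w => m m' mA m'A.
have sub x : x \in A -> (finsupp x `<=` d)%fset.
  by move=> xA; apply: bigfcup_sup.
rewrite (wtEw w (sub _ mA)) (wtEw w (sub _ m'A)) => /(wP _ _ mA m'A) e.
apply/eqP/cmP => i; have [/e//|id] := boolP (i \in d).
have z x : x \in A -> x i = 0%N.
  move=> /sub /fsubsetP/(_ i) xd; apply/eqP; rewrite cmE_eq0.
  by apply: contra id.
by rewrite !z.
Qed.

End Weights.

(** * Evaluation of polynomials along monomial maps *)

Definition zpoly (T : choiceType) := malg (cmonom T) int.

HB.instance Definition _ T := GRing.ComNzRing.copy (zpoly T) (malg (cmonom T) int).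

Section Zpoly.
Variable T : choiceType.
Implicit Types (p : zpoly T) (m : {cmonom T}).

Definition zmon m : zpoly T := << m >>.
Definition zcoef p m : int := mcoeff m p.
Definition zsupp p : {fset {cmonom T}} := msupp p.

Lemma zmonM m m' : zmon (mmul m m') = zmon m * zmon m'.
Proof. by rewrite /zmon [RHS]malgM_def fgmulUU mulr1. Qed.

Lemma zmon1 : zmon mone = 1.
Proof. by []. Qed.

Lemma zpolyE p : p = \sum_(m <- zsupp p) (zcoef p m)%:~R * zmon m.
Proof.
rewrite [LHS]monalgE; apply: eq_bigr => m _.
by rewrite mulrzl -[RHS](raddfMz (mkmalgU m)) intz.
Qed.

Lemma zpoly_supp_neq0 p : p != 0 -> exists2 m, m \in zsupp p & zcoef p m != 0.
Proof.
rewrite -[p == 0]msupp_eq0 => /fset0Pn[m mp]; exists m => //.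
by rewrite /zcoef mcoeff_neq0.
Qed.

Section Eval.
Variables (S : comNzRingType) (h : {cmonom T} -> S).
Hypothesis h_morph : mmorphism h.

Definition zeval p : S := \sum_(m <- zsupp p) (zcoef p m)%:~R * h m.

HB.instance Definition _ := isMultiplicative.Build _ _ h h_morph.

Let zevalE p : zeval p = mmap (intmul 1 : int -> S) h p.
Proof. by []. Qed.

Fact zeval_zmod_morphism : zmod_morphism zeval.
Proof. by move=> p q; rewrite !zevalE; exact: raddfB. Qed.

Fact zeval_monoid_morphism : monoid_morphism zeval.
Proof. by split=> [|p q]; rewrite !zevalE; [exact: rmorph1|exact: rmorphM]. Qed.

Lemma zeval_zmon m : zeval (zmon m) = h m.
Proof. by rewrite zevalE [LHS]mmapU; exact: mul1r. Qed.

End Eval.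
End Zpoly.

(** * Kronecker substitution and the absence of zero divisors *)

Section PolyDomain.
Variable T : choiceType.
Implicit Types (p q : zpoly T) (w : T -> nat).

Definition kron w (m : {cmonom T}) : {poly int} := 'X^(wt w m).

Lemma kron_mmorphism w : mmorphism (kron w).
Proof. by split=> [m m'|]; rewrite /kron ?wt1 ?expr0 // wtM exprD. Qed.

(** The monomials of [p] go to pairwise distinct powers of ['X], so no cancellation can occur. *)
Lemma zeval_kron_neq0 w p :
  {in zsupp p &, injective (wt w)} -> p != 0 -> zeval (kron w) p != 0.
Proof.
move=> winj /zpoly_supp_neq0[m mp pm].
apply/eqP => /(congr1 (coefp (wt w m))) /=.
rewrite coef_sum (big_fsetD1 m) //= big1_fset => [|i].
  rewrite addr0 -(rmorph_int (@polyC int)) coefCM coefXn eqxx mulr1 coef0 intz.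
  exact/eqP.
rewrite in_fsetD1 => /andP[im ip] _.
rewrite -(rmorph_int (@polyC int)) coefCM coefXn.
by case: eqP => [/winj e|]; [rewrite -e ?eqxx in im|rewrite mulr0].
Qed.

(** A single weight separates the monomials of both factors, which reduces the claim to univariate
    polynomials over the integers. *)
Lemma zpoly_mulf_eq0 p q : p * q = 0 -> (p == 0) || (q == 0).
Proof.
move=> pq0; have [//|p0] := eqVneq p 0; have [//|q0 /=] := eqVneq q 0.
have [w winj] := separating_weight (zsupp p `|` zsupp q)%fset.
have inj r : (zsupp r `<=` zsupp p `|` zsupp q)%fset ->
    {in zsupp r &, injective (wt w)}.
  by move=> /fsubsetP rpq m m' /rpq mA /rpq; apply: winj.
have kp := zeval_kron_neq0 (inj p (fsubsetUl _ _)) p0.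
have kq := zeval_kron_neq0 (inj q (fsubsetUr _ _)) q0.
have [_ /(_ p q)] := zeval_monoid_morphism (kron_mmorphism w).
rewrite pq0 => e; have := mulf_neq0 kp kq; rewrite -e /zeval /zsupp msupp0.
by rewrite big_seq_fset0 eqxx.
Qed.

Definition zpoly_unit : pred (zpoly T) := fun p => `[< exists q, q * p = 1 >].

(** Inverses are picked by choice; a non-unit is its own inverse, as the unit ring interface
    demands. *)
Definition zpoly_inv (p : zpoly T) : zpoly T :=
  if pselect (exists q, q * p = 1) is left e then sval (cid e) else p.

Lemma zpoly_mulVp : {in zpoly_unit, left_inverse 1 zpoly_inv *%R}.
Proof.
by move=> p /asboolP pU; rewrite /zpoly_inv; case: pselect => // e; case: cid.
Qed.

Lemma zpoly_unitPl (p q : zpoly T) : q * p = 1 -> zpoly_unit p.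
Proof. by move=> qp; apply/asboolP; exists q. Qed.

Lemma zpoly_inv_out : {in [predC zpoly_unit], zpoly_inv =1 id}.
Proof. by move=> p /asboolP pU; rewrite /zpoly_inv; case: pselect. Qed.

HB.instance Definition _ := GRing.ComNzRing_hasMulInverse.Build
  (zpoly T) zpoly_mulVp zpoly_unitPl zpoly_inv_out.
HB.instance Definition _ := GRing.ComUnitRing_isIntegral.Build
  (zpoly T) zpoly_mulf_eq0.

End PolyDomain.

(** * Orders of fractions along a rescaling of the variables *)

Local Notation "x %:F" := (@FracField.tofrac _ x) : ring_scope.

Lemma fraction_repr (D : idomainType) (x : {fraction D}) :
  exists p q : D, q != 0 /\ x = p%:F / q%:F.
Proof.
elim/quotW: x => -[[p q] /= q0]; exists p, q; split=> //.
have q0F : q%:F != 0 :> {fraction D} by rewrite tofrac_eq0.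
apply: (mulIf q0F); rewrite divfK //; unlock FracField.tofrac.
rewrite -[LHS]FracField.pi_mul; apply/eqmodP => /=.
by rewrite FracField.equivfE /FracField.mulf /= !numden_Ratio ?oner_neq0 ?mulr1 // mulrC.
Qed.

Section Specialization.
Variables (D : idomainType) (phi : {rmorphism D -> {poly D}}).
Hypothesis phi_inj : injective phi.
Implicit Types x y : {fraction D}.

(* With [phi] the substitution multiplying some of the variables by ['X],
   [const_frac] is the field of fractions in the other variables, while
   [local_frac] and [max_frac] are the valuation ring and maximal ideal of the
   order in the rescaled variables. *)
Definition const_frac x : Prop := exists p q : D,
  [/\ q != 0, x = p%:F / q%:F, phi p = p%:P & phi q = q%:P].

(** A common power of ['X] is split off and [v] keeps a nonzero constant term, so [x] has
    nonnegative order. The condition [P] on the constant term of [u] lets the valuation ring and its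
    maximal ideal share the sum and product lemmas. *)
Definition local_frac_at (P : D -> Prop) x : Prop :=
  exists (p q : D) (i : nat) (u v : {poly D}),
    [/\ x = p%:F / q%:F, phi p = u * 'X^i, phi q = v * 'X^i, v.[0] != 0 & P u.[0]].

Definition local_frac := local_frac_at (fun=> True).
Definition max_frac := local_frac_at (fun c => c = 0).

Lemma denom_neq0 (q : D) (i : nat) (v : {poly D}) :
  phi q = v * 'X^i -> v.[0] != 0 -> q%:F != 0 :> {fraction D}.
Proof.
move=> qE v0; rewrite tofrac_eq0; apply: contraNneq v0 => q0.
move/eqP: qE; rewrite q0 rmorph0 eq_sym mulf_eq0 expf_eq0 polyX_eq0 andbF orbF.
by move=> /eqP->; rewrite horner0.
Qed.

Lemma local_frac_add (P Q S : D -> Prop) x y :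
    (forall a b c d, P a -> Q b -> S (a * d + b * c)) ->
  local_frac_at P x -> local_frac_at Q y -> local_frac_at S (x + y).
Proof.
move=> PQS [p [q [i [u [v [-> pE qE v0 Pu]]]]]].
move=> [p' [q' [i' [u' [v' [-> p'E q'E v'0 Qu']]]]]].
exists (p * q' + p' * q), (q * q'), (i + i')%N, (u * v' + u' * v), (v * v').
split; last 2 first.
- by rewrite hornerM mulf_neq0.
- by rewrite hornerD !hornerM; apply: PQS.
- rewrite addf_div ?(denom_neq0 qE) ?(denom_neq0 q'E) //.
  by rewrite !(rmorphD, rmorphM).
- rewrite !(rmorphD, rmorphM) /= pE qE p'E q'E exprD mulrDl mulrACA.
  by congr (_ + _); rewrite mulrACA; congr (_ * _); apply: mulrC.
- by rewrite rmorphM /= qE q'E exprD mulrACA.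
Qed.

Lemma local_frac_mul (P Q S : D -> Prop) x y :
    (forall a b, P a -> Q b -> S (a * b)) ->
  local_frac_at P x -> local_frac_at Q y -> local_frac_at S (x * y).
Proof.
move=> PQS [p [q [i [u [v [-> pE qE v0 Pu]]]]]].
move=> [p' [q' [i' [u' [v' [-> p'E q'E v'0 Qu']]]]]].
exists (p * p'), (q * q'), (i + i')%N, (u * u'), (v * v').
split; last 2 first.
- by rewrite hornerM mulf_neq0.
- by rewrite hornerM; apply: PQS.
- by rewrite mulf_div !rmorphM.
- by rewrite rmorphM /= pE p'E exprD mulrACA.
- by rewrite rmorphM /= qE q'E exprD mulrACA.
Qed.

Lemma max_fracD x y : max_frac x -> max_frac y -> max_frac (x + y).
Proof. by apply: local_frac_add => a b c d -> ->; rewrite !mul0r addr0. Qed.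

Lemma max_fracM x y : max_frac x -> local_frac y -> max_frac (x * y).
Proof. by apply: local_frac_mul => a b -> _; rewrite mul0r. Qed.

Lemma local_fracD x y : local_frac x -> local_frac y -> local_frac (x + y).
Proof. exact: local_frac_add. Qed.

Lemma local_fracM x y : local_frac x -> local_frac y -> local_frac (x * y).
Proof. exact: local_frac_mul. Qed.

Lemma max_local_frac x : max_frac x -> local_frac x.
Proof. by move=> [p [q [i [u [v [? ? ? ? _]]]]]]; exists p, q, i, u, v. Qed.

Lemma local_fracV x : local_frac x -> ~ max_frac x -> local_frac x^-1.
Proof.
move=> [p [q [i [u [v [xE pE qE v0 _]]]]]] xM.
exists q, p, i, v, u; split=> //; first by rewrite xE invf_div.
by apply/eqP => u0; apply: xM; exists p, q, i, u, v.
Qed.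

Lemma const_frac_poly (p : D) : phi p = p%:P -> const_frac p%:F.
Proof.
move=> pE; exists p, 1; split=> //; rewrite ?oner_neq0 ?rmorph1 ?divr1 //.
Qed.

Lemma const_fracD x y : const_frac x -> const_frac y -> const_frac (x + y).
Proof.
move=> [p [q [q0 -> pE qE]]] [p' [q' [q'0 -> p'E q'E]]].
exists (p * q' + p' * q), (q * q'); rewrite mulf_neq0 //; split=> //.
- by rewrite addf_div ?tofrac_eq0 // !(rmorphD, rmorphM).
- by rewrite !(rmorphD, rmorphM) /= pE qE p'E q'E.
- by rewrite !rmorphM /= qE q'E.
Qed.

Lemma const_fracN x : const_frac x -> const_frac (- x).
Proof.
move=> [p [q [q0 -> pE qE]]]; exists (- p), q; split=> //.
- by rewrite rmorphN mulNr.
- by rewrite !rmorphN /= pE.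
Qed.

Lemma const_fracM x y : const_frac x -> const_frac y -> const_frac (x * y).
Proof.
move=> [p [q [q0 -> pE qE]]] [p' [q' [q'0 -> p'E q'E]]].
exists (p * p'), (q * q'); rewrite mulf_neq0 //; split=> //.
- by rewrite mulf_div !rmorphM.
- by rewrite !rmorphM /= pE p'E.
- by rewrite !rmorphM /= qE q'E.
Qed.

Lemma const_frac0 : const_frac 0.
Proof.
rewrite -[0](rmorph0 (@FracField.tofrac D)).
by apply: const_frac_poly; rewrite !rmorph0.
Qed.

Lemma const_frac1 : const_frac 1.
Proof.
rewrite -[1](rmorph1 (@FracField.tofrac D)).
by apply: const_frac_poly; rewrite !rmorph1.
Qed.

Lemma const_fracV x : const_frac x -> const_frac x^-1.
Proof.
move=> [p [q [q0 xE pE qE]]]; have [p0|p0] := eqVneq p 0.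
  by rewrite xE p0 rmorph0 mul0r invr0; apply: const_frac0.
by exists q, p; split=> //; rewrite xE invf_div.
Qed.

Lemma const_local_frac x : const_frac x -> local_frac x.
Proof.
move=> [p [q [q0 -> pE qE]]]; exists p, q, 0%N, p%:P, q%:P.
by split; rewrite ?mulr1 ?hornerC.
Qed.

(** Cross-multiplying the two representations of [x], applying [phi], cancelling ['X^i] and setting
    ['X] to 0 leaves [p * v.[0] = 0]. *)
Lemma const_max_frac x : const_frac x -> max_frac x -> x = 0.
Proof.
move=> [p [q [q0 xE pE qE]]] [p' [q' [i [u [v [xE' p'E q'E v0 u0]]]]]].
have q'0 := denom_neq0 q'E v0.
have : p * q' = p' * q.
  have qF : q%:F != 0 :> {fraction D} by rewrite tofrac_eq0.
  apply/eqP; rewrite -tofrac_eq !rmorphM /=.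
  by rewrite -(eqr_div _ _ qF q'0) -xE -xE'.
move/(congr1 phi); rewrite !rmorphM /= pE qE p'E q'E mulrA [RHS]mulrAC.
have Xi0 : 'X^i != 0 :> {poly D} by rewrite expf_neq0 ?polyX_eq0.
move/(mulIf Xi0)/(congr1 (horner^~ 0)); rewrite !hornerM !hornerC u0 mul0r => /eqP.
by rewrite mulf_eq0 (negPf v0) orbF xE => /eqP->; rewrite rmorph0 mul0r.
Qed.

Lemma max_fracN x : max_frac x -> max_frac (- x).
Proof.
move=> xM; rewrite -mulrN1; apply: max_fracM => //.
by apply: const_local_frac; apply/const_fracN/const_frac1.
Qed.

Lemma max_frac0 : max_frac 0.
Proof.
exists 0, 1, 0%N, 0, 1; split; rewrite ?rmorph0 ?rmorph1 ?mul0r ?mulr1 ?horner0 //.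
by rewrite hornerC oner_neq0.
Qed.

Lemma max_frac_var (t : D) : phi t = t%:P * 'X -> max_frac t%:F.
Proof.
move=> tE; exists t, 1, 0%N, (t%:P * 'X), 1.
by rewrite !rmorph1 !mulr1 divr1 hornerC oner_neq0 hornerM hornerX mulr0.
Qed.

(** The order of [p] is below the size of [phi p], hence below [n], while each of the [n] factors
    [a] has order at least 1; the factor [q] can only raise the order. *)
Lemma max_frac_exp_div (p q : D) (a : {fraction D}) n : p != 0 -> (size (phi p) <= n)%N ->
  q != 0 -> max_frac a -> max_frac (a ^+ n / (p%:F / q%:F)).
Proof.
move=> p0 sn q0 [p' [q' [i [u [v [-> p'E q'E v0 u0]]]]]].
have [j [r]] := multiplicity_XsubC (phi p) 0.
rewrite subr0; have pp0 : phi p != 0.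
  by apply: contraNneq p0; rewrite -[RHS](rmorph0 phi) => /phi_inj/eqP.
rewrite pp0 /= => rr pE.
have r0 : r.[0] != 0 by [].
have rnz : r != 0 by apply: contraNneq r0 => ->; rewrite horner0.
have jn : (j < n)%N.
  apply: leq_trans sn; rewrite pE size_Mmonic ?monicXn // size_polyXn addnS /=.
  by rewrite -[ltnLHS]add0n ltn_add2r size_poly_gt0.
have [u' uE] : exists u', u = u' * 'X.
  have /factor_theorem[u' ->] : root u 0 by rewrite /root u0.
  by exists u'; rewrite subr0.
(* The [n] copies of ['X] coming from [u = u' * 'X] outweigh the factor ['X^j] of [phi p]. The
   surplus ['X^(n - j)] makes the constant term vanish. *)
exists (p' ^+ n * q), (q' ^+ n * p), (i * n + j)%N,
  (u' ^+ n * phi q * 'X^(n - j)), (v ^+ n * r).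
have Xij : 'X^(n - j) * 'X^(i * n + j) = 'X^n * 'X^i ^+ n :> {poly D}.
  by rewrite -exprM -!exprD addnCA subnK 1?ltnW // addnC.
split.
- by rewrite invf_div expr_div_n mulf_div !(rmorphM, rmorphXn).
- rewrite rmorphM rmorphXn /= p'E uE !exprMn -[RHS]mulrA Xij.
  by rewrite [RHS]mulrAC !mulrA.
- by rewrite rmorphM rmorphXn /= q'E pE !exprMn exprD -exprM mulrACA.
- by rewrite hornerM horner_exp mulf_neq0 ?expf_neq0.
- by rewrite hornerM hornerXn expr0n subn_eq0 leqNgt jn mulr0.
Qed.

End Specialization.

(** * Rescaling the variables outside a set *)

Section Scaling.
Variable T : choiceType.
Implicit Types (A : set T) (p : zpoly T) (m : {cmonom T}) (i : T).

Definition off A i : nat := ~~ `[< A i >].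

Definition scale_mon A m : {poly zpoly T} := (zmon m)%:P * 'X^(wt (off A) m).

Lemma scale_mon_mmorphism A : mmorphism (scale_mon A).
Proof.
split=> [m m'|]; rewrite /scale_mon; last by rewrite wt1 expr0 mulr1 zmon1.
by rewrite zmonM polyCM wtM exprD mulrACA.
Qed.

Definition scale A : zpoly T -> {poly zpoly T} := zeval (scale_mon A).

HB.instance Definition _ A := GRing.isZmodMorphism.Build _ _ (scale A)
  (zeval_zmod_morphism (scale_mon A)).
HB.instance Definition _ A := GRing.isMonoidMorphism.Build _ _ (scale A)
  (zeval_monoid_morphism (scale_mon_mmorphism A)).

Definition zvar i : zpoly T := zmon (ucm i).

Lemma scale_zvar A i : scale A (zvar i) = (zvar i)%:P * 'X^(off A i).
Proof. by rewrite /scale zeval_zmon /scale_mon wtU. Qed.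

Lemma scale_zvar_in A i : A i -> scale A (zvar i) = (zvar i)%:P.
Proof. by move=> Ai; rewrite scale_zvar /off asboolT // mulr1. Qed.

Lemma scale_zvar_out A i : ~ A i -> scale A (zvar i) = (zvar i)%:P * 'X.
Proof. by move=> Ai; rewrite scale_zvar /off asboolF. Qed.

(** Setting ['X] to 1 undoes the rescaling, whence its injectivity. *)
Lemma scale_horner1 A p : (scale A p).[1] = p.
Proof.
rewrite /scale /zeval horner_sum [RHS]zpolyE; apply: eq_bigr => m _.
rewrite -(rmorph_int (@polyC (zpoly T))).
by rewrite !hornerM !hornerC hornerXn expr1n mulr1.
Qed.

Lemma scale_inj A : injective (scale A).
Proof. by move=> p q e; rewrite -(scale_horner1 A p) e scale_horner1. Qed.

(** Each variable contributes at most one ['X], so the total degree bounds the power of ['X]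
    whatever [A] is. This uniformity later yields one exponent valid at all points. *)
Lemma size_scale p : exists n, forall A, (size (scale A p) <= n)%N.
Proof.
exists (\max_(m <- zsupp p) mdeg m).+1 => A; rewrite /scale /zeval.
apply: (leq_trans (size_sum _ _ _)); rewrite big_seq; apply/bigmax_leqP_seq.
move=> m mp _; rewrite -(rmorph_int (@polyC (zpoly T))) mulrA -polyCM.
apply: (leq_trans (size_polyMleq _ _)); rewrite size_polyXn addnS /=.
rewrite -add1n leq_add ?size_polyC_leq1 //.
apply: (@leq_trans (mdeg m)); last exact: leq_bigmax_seq.
by apply: leq_wt_mdeg => i; apply: leq_b1.
Qed.

Definition one_mon m : int := 1.

Lemma one_mon_mmorphism : mmorphism one_mon.
Proof. by split=> // m m'; rewrite /one_mon mulr1. Qed.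

(** Setting all variables to 1 is the test by which sums of monomials are seen to be nonzero. *)
Definition total_eval : zpoly T -> int := zeval one_mon.

HB.instance Definition _ := GRing.isZmodMorphism.Build _ _ total_eval
  (zeval_zmod_morphism one_mon).
HB.instance Definition _ := GRing.isMonoidMorphism.Build _ _ total_eval
  (zeval_monoid_morphism one_mon_mmorphism).

Lemma total_eval_zvar i : total_eval (zvar i) = 1.
Proof. by rewrite /total_eval zeval_zmon. Qed.

End Scaling.

(** * The ring of a closure system *)

Lemma sub_div (F : fieldType) (u v b c : F) : b != 0 -> c != 0 ->
  u / b - v / c = (u - v) / b - (b - c) * (v / c / b).
Proof. by move=> b0 c0; field; rewrite b0 c0. Qed.

Section PrimeIdeal.
Variables (R : comPzRingType) (P : set R).
Hypothesis P_prime : prime_ideal P.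

Lemma prime_exp a n : P (a ^+ n) -> P a.
Proof.
elim: n => [|n IH]; first by rewrite expr0 => /(prime1 P_prime).
by rewrite exprS => /(primeM P_prime)[].
Qed.

Lemma prime_sum (I : eqType) (s : seq I) (f : I -> R) :
  (forall i, i \in s -> P (f i)) -> P (\sum_(i <- s) f i).
Proof.
move=> sP; rewrite big_seq; elim/big_ind: _ => //; first exact: prime0 P_prime.
exact: primeD P_prime.
Qed.

Lemma prime_prod (I : eqType) (s : seq I) (f : I -> R) :
  P (\prod_(i <- s) f i) -> exists2 i, i \in s & P (f i).
Proof.
elim: s => [|i s IH]; first by rewrite big_nil => /(prime1 P_prime).
rewrite big_cons => /(primeM P_prime)[Pi|/IH[j js Pj]].
  by exists i; rewrite ?mem_head.
by exists j; rewrite ?inE ?js ?orbT.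
Qed.

Lemma prime_prod_mem (I : choiceType) (s : {fset I}) (f : I -> R) i :
  i \in s -> P (f i) -> P (\prod_(i <- s) f i).
Proof.
move=> is_ Pi; rewrite (big_fsetD1 i) //= mulrC.
exact: primeMl P_prime _ _ Pi.
Qed.

End PrimeIdeal.

Section Springs.
Variables (T : choiceType) (D : idomainType).
Variables (scale : set T -> {rmorphism D -> {poly D}}) (var : T -> D).
Variable total : {rmorphism D -> int}.
Hypothesis scale_inj : forall A, injective (scale A).
Hypothesis size_scale :
  forall p, exists n, forall A, (size (scale A p) <= n)%N.
Hypothesis scale_in : forall A i, A i -> scale A (var i) = (var i)%:P.
Hypothesis scale_out : forall A i, ~ A i -> scale A (var i) = (var i)%:P * 'X.
Hypothesis total_var : forall i, total (var i) = 1.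

Lemma max_frac_exp_div_uniform (x : {fraction D}) : x != 0 ->
  exists n0, forall n A a, (n0 <= n)%N ->
    max_frac (scale A) a -> max_frac (scale A) (a ^+ n / x).
Proof.
have [p [q [q0 ->]]] := fraction_repr x; rewrite mulf_eq0 negb_or tofrac_eq0.
move=> /andP[p0 _]; have [n0 n0P] := size_scale p; exists n0 => n A a n0n aM.
by apply: max_frac_exp_div => //; exact: leq_trans (n0P A) n0n.
Qed.

Variables (Y : Type) (mem : Y -> set T) (cl : set T -> Y).
Hypothesis cl_ext : forall S, S `<=` mem (cl S).
Hypothesis cl_min : forall S y, S `<=` mem y -> mem (cl S) `<=` mem y.
Implicit Types (y z : Y) (S : set T) (C E : {fset T}).

Local Notation K := {fraction D}.
Local Notation const y := (const_frac (scale (mem y))).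
Local Notation max y := (max_frac (scale (mem y))).
Local Notation loc y := (local_frac (scale (mem y))).

Definition spring_pred (r : Y -> K) : Prop :=
  [/\ forall y, const y (r y),
      forall y z, mem z `<=` mem y -> max z (r y - r z)
    & exists E, forall y z,
        (forall i, i \in E -> mem y i <-> mem z i) -> r y = r z].

Definition spring_set : pred (Y -> K) := fun r => `[< spring_pred r >].

(** For products, the difference is split as [(r y - r z) * s y + (s y - s z) * r z]. The factor
    [s y] lies in the valuation ring at [z], since it differs from the constant [s z] by an element
    of the maximal ideal. *)
Fact spring_subring : subring_closed spring_set.
Proof.
split.
- apply/asboolP; split=> [y|y z _|]; first exact: const_frac1.
    by rewrite subrr; apply: max_frac0.
  by exists fset0.
- move=> r s /asboolP[r1 r2 [E rE]] /asboolP[s1 s2 [E' sE]]; apply/asboolP; split.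
  + by move=> y; apply: const_fracD => //; apply: const_fracN.
  + move=> y z zy; rewrite [X in max z X](_ : _ = (r y - r z) - (s y - s z)).
      by apply: max_fracD; [exact: r2|apply: max_fracN; exact: s2].
    transitivity ((r y - s y) - (r z - s z)); first by [].
    by rewrite !opprB [s z - r z]addrC addrACA [- s y + _]addrC.
  + exists (E `|` E')%fset => y z yz; congr (_ - _).
      by apply: rE => i iE; apply: yz; rewrite inE iE.
    by apply: sE => i iE; apply: yz; rewrite inE iE orbT.
- move=> r s /asboolP[r1 r2 [E rE]] /asboolP[s1 s2 [E' sE]]; apply/asboolP; split.
  + by move=> y; apply: const_fracM.
  + move=> y z zy.
    have sl : loc z (s y).
      rewrite -(subrK (s z) (s y)); apply: local_fracD.
        exact/max_local_frac/s2.
      exact: const_local_frac.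
    rewrite [X in max z X](_ : _ = (r y - r z) * s y + (s y - s z) * r z).
      by apply: max_fracD; apply: max_fracM;
        [exact: r2|exact: sl|exact: s2|exact: const_local_frac].
    transitivity (r y * s y - r z * s z); first by [].
    by rewrite !mulrBl addrA [s y * _]mulrC subrK [s z * _]mulrC.
  + exists (E `|` E')%fset => y z yz; congr (_ * _).
      by apply: rE => i iE; apply: yz; rewrite inE iE.
    by apply: sE => i iE; apply: yz; rewrite inE iE orbT.
Qed.

Definition spring := {r : Y -> K | spring_set r}.

HB.instance Definition _ := [isSub of spring for @sval _ _].
HB.instance Definition _ := [Choice of spring by <:].
HB.instance Definition _ :=
  GRing.SubChoice_isSubComPzRing.Build (Y -> K) spring_set spring spring_subring.

Implicit Types (r s a b : spring) (i : T).

Definition ev y r : K := val r y.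

Fact ev_zmod_morphism y : zmod_morphism (ev y).
Proof. by move=> r s; rewrite /ev raddfB. Qed.

Fact ev_monoid_morphism y : monoid_morphism (ev y).
Proof. by split=> [|r s]; rewrite /ev ?rmorph1 // rmorphM. Qed.

HB.instance Definition _ y :=
  GRing.isZmodMorphism.Build _ _ (ev y) (ev_zmod_morphism y).
HB.instance Definition _ y :=
  GRing.isMonoidMorphism.Build _ _ (ev y) (ev_monoid_morphism y).

Lemma springP r : spring_pred (fun y => ev y r).
Proof. exact/asboolP/(valP r). Qed.

Lemma ev_inj r s : (forall y, ev y r = ev y s) -> r = s.
Proof. by move=> rs; apply: val_inj; apply/funext => y; apply: rs. Qed.

Lemma spring_of (f : Y -> K) : spring_pred f -> exists r, forall y, ev y r = f y.
Proof. by move=> /asboolP fP; exists (Sub f fP) => y; rewrite /ev SubK. Qed.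

Lemma ev_const y r : const y (ev y r).
Proof. by have [] := springP r. Qed.

Lemma ev_max y z r : mem z `<=` mem y -> max z (ev y r - ev z r).
Proof. by have [_ h _] := springP r; apply: h. Qed.

Lemma ev_loc y z r : mem z `<=` mem y -> loc z (ev y r).
Proof.
move=> zy; rewrite -(subrK (ev z r) (ev y r)); apply: local_fracD.
  exact/max_local_frac/ev_max.
exact/const_local_frac/ev_const.
Qed.

(** A nonzero constant is outside the maximal ideal at [z], and [ev y r] is congruent to the
    constant [ev z r]. So [ev y r] is a unit of the valuation ring, and supports are closed
    upwards. *)
Lemma ev_unit y z r : mem z `<=` mem y -> ev z r != 0 -> ~ max z (ev y r).
Proof.
move=> zy rz yM; case/eqP: rz; apply: (@const_max_frac _ (scale (mem z))).
  exact: ev_const.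
rewrite -[ev z r](subKr (ev y r)); apply: max_fracD => //.
by apply: max_fracN; apply: ev_max.
Qed.

Lemma ev_up y z r : mem z `<=` mem y -> ev z r != 0 -> ev y r != 0.
Proof.
move=> zy /(ev_unit zy); apply: contra_not_neq => ->; exact: max_frac0.
Qed.

Definition trace E y : {fset T} := [fset i in E | `[< mem y i >]]%fset.

Lemma trace_sub E y : [set` trace E y] `<=` mem y.
Proof. by move=> i /=; rewrite !inE => /andP[_ /asboolP]. Qed.

(** A point and the closure of its trace on [E] contain the same elements of [E]. Hence [r] takes
    only finitely many values, indexed by subsets of [E]. *)
Lemma ev_trace r : exists E, forall y, ev y r = ev (cl [set` trace E y]) r.
Proof.
have [_ _ [E rE]] := springP r; exists E => y; apply: rE => i iE; split.
  by move=> yi; apply: cl_ext; rewrite /= !inE iE; apply/asboolP.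
by apply: cl_min; apply: trace_sub.
Qed.

(** Each of the finitely many nonzero values of [b] has its own exponent bound; their maximum serves
    every point. *)
Lemma ev_max_exp_div b : exists n0, forall n y z (c : K),
  (n0 <= n)%N -> ev y b != 0 -> max z c -> max z (c ^+ n / ev y b).
Proof.
have [E bE] := ev_trace b.
have /choice[f fP] : forall C, exists n0, ev (cl [set` C]) b != 0 ->
    forall n A c, (n0 <= n)%N -> max_frac (scale A) c ->
      max_frac (scale A) (c ^+ n / ev (cl [set` C]) b).
  move=> C; have [b0|b0] := eqVneq (ev (cl [set` C]) b) 0; first by exists 0%N.
  by have [n0 n0P] := max_frac_exp_div_uniform b0; exists n0.
exists (\max_(C <- fpowerset E) f C)%N => n y z c nb.
rewrite (bE y) => b0; apply: (fP _ b0); apply: leq_trans nb.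
apply: leq_bigmax_seq => //; rewrite fpowersetE; apply/fsubsetP => i.
by rewrite !inE => /andP[].
Qed.

Lemma evXn y a n : ev y (a ^+ n) = ev y a ^+ n.
Proof. exact: rmorphXn. Qed.

Lemma evM y a b : ev y (a * b) = ev y a * ev y b.
Proof.
exact: (ev_monoid_morphism y).2.
Qed.

(** Both values of [b] are units at [z], so [sub_div] writes the difference as elements of the
    maximal ideal times elements of the valuation ring. *)
Lemma max_sub_div y z a b : mem z `<=` mem y -> ev z b != 0 ->
  max z (ev y a / ev y b - ev z a / ev z b).
Proof.
move=> zy bz0; rewrite (sub_div _ _ (ev_up zy bz0) bz0).
have lb : loc z (ev y b)^-1.
  by apply: local_fracV; [exact: ev_loc|exact: ev_unit].
apply: max_fracD; [|apply: max_fracN].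
  by apply: max_fracM lb; exact: ev_max.
apply: max_fracM; first exact: ev_max.
apply: local_fracM lb; apply/const_local_frac/const_fracM.
  exact: ev_const.
exact/const_fracV/ev_const.
Qed.

(* If [a] vanishes wherever [b] does, then at a specialisation where [b] vanishes
   the poles of [1 / b] are dominated by a high power of [a]. *)
Lemma exists_quotient a b : (forall y, ev y b = 0 -> ev y a = 0) ->
  exists n c, forall y, ev y c = ev y a ^+ n.+1 / ev y b.
Proof.
move=> ab; have [n n0P] := ev_max_exp_div b; exists n.
have [_ _ [Ea aE]] := springP a; have [_ _ [Eb bE]] := springP b.
apply: spring_of; split.
- move=> y; apply: const_fracM; last exact/const_fracV/ev_const.
  by rewrite -evXn; apply: ev_const.
(* Since the inverse of 0 is 0, the quotient vanishes wherever [b] does. If only [ev z b] is 0, then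
   [ev y a] is in the maximal ideal at [z] and its power absorbs the pole. *)
- move=> y z zy; have [bz0|bz0] := eqVneq (ev z b) 0.
    rewrite bz0 invr0 mulr0 subr0; have [->|by0] := eqVneq (ev y b) 0.
      by rewrite invr0 mulr0; apply: max_frac0.
    apply: n0P => //; rewrite -[ev y a]subr0 -(ab z bz0); exact: ev_max.
  by rewrite -!evXn; apply: max_sub_div.
- exists (Ea `|` Eb)%fset => y z yz; congr (_ ^+ _ / _).
    by apply: aE => i iE; apply: yz; rewrite inE iE.
  by apply: bE => i iE; apply: yz; rewrite inE iE orbT.
Qed.

Lemma spring_division a b : (forall y, ev y b = 0 -> ev y a = 0) ->
  exists n c, a ^+ n = c * b.
Proof.
move=> ab; have [n [c cE]] := exists_quotient ab; exists n.+1, c.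
apply: ev_inj => y; rewrite evM evXn cE.
have [b0|b0] := eqVneq (ev y b) 0; last by rewrite divfK.
(* The exponent is a successor, so the power of 0 is 0 and not 1. *)
by rewrite (ab _ b0) b0 mulr0 expr0n.
Qed.

(** The drop from [var i] to 0 is compatible with specialisation because [var i] has order 1 at
    every point omitting [i]. *)
Lemma exists_coord i : exists r, forall y,
  ev y r = if `[< mem y i >] then (var i)%:F else 0.
Proof.
apply: spring_of; split.
- move=> y; case: asboolP => yi; last exact: const_frac0.
  by apply: const_frac_poly; rewrite scale_in.
- move=> y z zy; case: (asboolP (mem z i)) => zi.
    by rewrite asboolT ?subrr; [exact: max_frac0|exact: zy].
  rewrite subr0; case: asboolP => yi; last exact: max_frac0.
  by apply: max_frac_var; rewrite scale_out.
- exists [fset i]%fset => y z yz; rewrite (_ : `[< mem y i >] = `[< mem z i >]) //.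
  by apply: asbool_equiv_eq; apply: yz; rewrite inE.
Qed.

Definition coord_fun i : spring := sval (cid (exists_coord i)).

Lemma ev_coord y i : ev y (coord_fun i) = if `[< mem y i >] then (var i)%:F else 0.
Proof. by rewrite /coord_fun; case: cid. Qed.

Lemma var_neq0 i : var i != 0.
Proof.
by apply/eqP => /(congr1 (total)); rewrite total_var rmorph0.
Qed.

Lemma ev_coord_neq0 y i : ev y (coord_fun i) != 0 <-> mem y i.
Proof.
rewrite ev_coord; case: asboolP => yi; last by rewrite eqxx.
by rewrite tofrac_eq0 var_neq0.
Qed.

Definition mono_fun C : spring := \prod_(i <- C) coord_fun i.

Lemma ev_mono y C : ev y (mono_fun C) =
  if `[< [set` C] `<=` mem y >] then (\prod_(i <- C) var i)%:F else 0.
Proof.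
rewrite /mono_fun rmorph_prod /=; case: asboolP => Cy.
  rewrite rmorph_prod /= !big_seq; apply: eq_bigr => i iC.
  by rewrite ev_coord asboolT //; apply: Cy.
have [i [iC yi]] : exists i, i \in C /\ ~ mem y i.
  by move/existsNP: Cy => [i /not_implyP]; exists i.
by rewrite (big_fsetD1 i) //= ev_coord asboolF // mul0r.
Qed.

Lemma ev_mono_neq0 y C : ev y (mono_fun C) != 0 <-> [set` C] `<=` mem y.
Proof.
rewrite ev_mono; case: asboolP => yi; last by rewrite eqxx.
by rewrite tofrac_eq0 prodf_seq_neq0; split=> // _; apply/allP => i _; rewrite var_neq0.
Qed.

(* A sum of monomials does not vanish unless all its terms do, by evaluating all
   variables at [1]. *)
Lemma ev_sum_mono y (X : seq {fset T}) C : C \in X -> [set` C] `<=` mem y ->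
  ev y (\sum_(C <- X) mono_fun C) != 0.
Proof.
move=> CX Cy; rewrite rmorph_sum /=.
rewrite (eq_bigr (fun C => (if `[< [set` C] `<=` mem y >]
    then \prod_(i <- C) var i else 0)%:F)); last first.
  by move=> C' _; rewrite ev_mono; case: ifP => // _; rewrite rmorph0.
rewrite -rmorph_sum /= tofrac_eq0; apply/eqP => /(congr1 (total)).
rewrite rmorph0 rmorph_sum /= => /eqP; rewrite psumr_eq0 => [/allP/(_ C CX)|C' _].
  rewrite /= asboolT // rmorph_prod /= big1 // => i _; exact: total_var.
case: ifP => _; last by rewrite rmorph0.
by rewrite rmorph_prod /= prodr_ge0 // => i _; rewrite total_var.
Qed.

(** The sets [C] are the subsets of [E] at whose closure [r] is nonzero; [ev_up] carries this to all
    larger points. *)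
Lemma spring_support r : exists X : seq {fset T}, forall y,
  ev y r != 0 <-> exists2 C, C \in X & [set` C] `<=` mem y.
Proof.
have [E rE] := ev_trace r.
exists [seq C <- fpowerset E | ev (cl [set` C]) r != 0] => y; split.
  rewrite rE => r0; exists (trace E y); last exact: trace_sub.
  rewrite mem_filter r0 fpowersetE; apply/fsubsetP => i.
  by rewrite !inE => /andP[].
move=> [C]; rewrite mem_filter => /andP[r0 _] Cy.
by apply: ev_up r0; apply: cl_min.
Qed.

(** The doubly negated vanishing condition matches the form [~ supp r y] used in [exists_spring]. *)
Lemma ev_prime y : prime_ideal [set r : spring | ~ ev y r != 0].
Proof.
have evN0 r : (~ ev y r != 0) = (ev y r = 0).
  by apply/propext; split=> [/negP/negPn/eqP|->]; rewrite ?eqxx.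
split=> [|r s|a r||r s]; rewrite /mkset ?evN0.
- exact: rmorph0.
- by move=> r0 s0; rewrite rmorphD /= r0 s0 addr0.
- by move=> r0; rewrite evM r0 mulr0.
- by rewrite rmorph1 => /eqP; rewrite oner_eq0.
- by rewrite evM => /eqP; rewrite mulf_eq0 => /orP[]/eqP; [left|right].
Qed.

(** * Every prime ideal comes from a point *)

Hypothesis cl_fin : forall S i, mem (cl S) i ->
  exists C, [set` C] `<=` S /\ mem (cl [set` C]) i.

Section Points.
Variable P : set spring.
Hypothesis P_prime : prime_ideal P.

Definition prime_trace : set T := [set i | ~ P (coord_fun i)].

Lemma prime_mono_fun C : ~ P (mono_fun C) <-> [set` C] `<=` prime_trace.
Proof.
split=> [nP i iC Pi|CP /(prime_prod P_prime)[i iC Pi]]; last exact: (CP i).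
by apply: nP; exact: (prime_prod_mem P_prime iC).
Qed.

Lemma division_prime a b : (forall y, ev y b = 0 -> ev y a = 0) -> P b -> P a.
Proof.
move=> /spring_division[n [c acb]] Pb; apply: (@prime_exp _ _ P_prime a n).
by rewrite acb; apply: primeMl P_prime _ _ Pb.
Qed.

Lemma ev_eq0 y r : ev y r = 0 <-> ~ ev y r != 0.
Proof. by split=> [->|/negP/negPn/eqP//]; rewrite eqxx. Qed.

(** If [i] is in the closure, it is in the closure of a finite part [C] of the trace, so
    [mono_fun C] vanishes wherever [coord_fun i] does. Were [coord_fun i] in [P], so would be
    [mono_fun C], a product of elements outside [P]. *)
Lemma mem_cl_prime_trace : mem (cl prime_trace) = prime_trace.
Proof.
apply/seteqP; split=> [i /cl_fin[C [CP iC]] Pi|]; last exact: cl_ext.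
move/prime_mono_fun: CP; apply; apply: division_prime Pi => y.
move=> /ev_eq0; rewrite ev_coord_neq0 => yi; apply/ev_eq0.
rewrite ev_mono_neq0 => Cy; apply: yi; exact: (cl_min Cy).
Qed.

(** By division, membership in [P] depends only on supports, and [r] has the support of a finite sum
    of monomials. Membership of a monomial is read off from the trace. *)
Lemma prime_ev r : P r <-> ~ ev (cl prime_trace) r != 0.
Proof.
have [X XP] := spring_support r; rewrite XP; split.
  move=> Pr [C CX]; rewrite mem_cl_prime_trace => /prime_mono_fun; apply.
  apply: division_prime Pr => y /ev_eq0 ry; apply/ev_eq0.
  by rewrite ev_mono_neq0 => Cy; apply: ry; apply/XP; exists C.
move=> nX; apply: (@division_prime r (\sum_(C <- X) mono_fun C)) => [y|].
  move=> /ev_eq0 by0; apply/ev_eq0; rewrite XP => -[C CX Cy].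
  by apply: by0; apply: ev_sum_mono CX Cy.
apply: (prime_sum P_prime) => C CX; apply: contrapT => /prime_mono_fun CP.
by apply: nX; exists C => //; rewrite mem_cl_prime_trace.
Qed.

End Points.
End Springs.

(** The ring enters the topological argument only through the supports of its elements, so only
    these are exported. *)
Theorem exists_spring (T : choiceType) (Y : Type) (mem : Y -> set T)
    (cl : set T -> Y)
    (cl_ext : forall S, S `<=` mem (cl S))
    (cl_min : forall S y, S `<=` mem y -> mem (cl S) `<=` mem y)
    (cl_fin : forall S i, mem (cl S) i ->
      exists C : {fset T}, [set` C] `<=` S /\ mem (cl [set` C]) i) :
  exists (R : comPzRingType) (supp : R -> set Y) (f : {fset T} -> R),
    [/\ forall y, prime_ideal [set r | ~ supp r y],
        forall P, prime_ideal P -> exists y, forall r, P r <-> ~ supp r y,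
        forall C y, supp (f C) y <-> [set` C] `<=` mem y
      & forall r, exists X : seq {fset T}, forall y,
          supp r y <-> exists2 C, C \in X & [set` C] `<=` mem y].
Proof.
pose scl (A : set T) : {rmorphism zpoly T -> {poly zpoly T}} := scale A.
have sin A i : A i -> scl A (zvar i) = (zvar i)%:P by exact: scale_zvar_in.
have sout A i : ~ A i -> scl A (zvar i) = (zvar i)%:P * 'X.
  exact: scale_zvar_out.
exists (spring scl mem), (fun r => [set y | ev y r != 0]), (mono_fun sin sout mem).
split.
- exact: ev_prime.
- move=> P P_prime; exists (cl (prime_trace sin sout P)) => r.
  by apply: prime_ev => //; [exact: scale_inj|exact: size_scale|exact: total_eval_zvar].
- by move=> C y; apply: ev_mono_neq0; exact: total_eval_zvar.
- exact: spring_support.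
Qed.

(** * Spectral spaces of closed sets *)

Lemma Spec_eq (R : comPzRingType) (P Q : Spec R) :
  (forall r, (P : set R) r <-> (Q : set R) r) -> P = Q.
Proof.
case: P Q => [P pP] [Q pQ] /= /predeqP PQ; subst Q.
by congr mkSpec; apply: Prop_irrelevance.
Qed.

(** A point goes to the prime of elements vanishing there, and singletons [C] recover the point.
    Supports are finite unions of the basic opens, and each basic open is the support of some [f C],
    so both maps are continuous. *)
Theorem spectral_closure_system (T : choiceType) (Y : topologicalType)
    (mem : Y -> set T) (cl : set T -> Y)
    (mem_inj : injective mem)
    (cl_ext : forall S, S `<=` mem (cl S))
    (cl_min : forall S y, S `<=` mem y -> mem (cl S) `<=` mem y)
    (cl_fin : forall S i, mem (cl S) i ->
      exists C : {fset T}, [set` C] `<=` S /\ mem (cl [set` C]) i)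
    (open_above : forall C : {fset T}, open [set y | [set` C] `<=` mem y])
    (open_base : forall (O : set Y) y, open O -> O y ->
      exists C : {fset T}, [set` C] `<=` mem y /\
        [set z | [set` C] `<=` mem z] `<=` O) :
  spectral_space Y.
Proof.
have [R [supp [f [supp_prime prime_supp supp_f suppP]]]] :=
  exists_spring cl_ext cl_min cl_fin.
pose F y : Spec R := mkSpec (supp_prime y).
have /choice[G GP] : forall P : Spec R, exists y, forall r,
    (P : set R) r <-> ~ supp r y.
  by move=> P; apply: prime_supp; apply: spec_prime.
have supp1 i y : supp (f [fset i]%fset) y <-> mem y i.
  rewrite supp_f; split=> [|yi j /=]; first by apply; rewrite /= inE.
  by rewrite inE => /eqP ->.
exists R, F, G; split.
- move=> y; apply: mem_inj; apply/predeqP => i.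
  have e := GP (F y) (f [fset i]%fset); rewrite /= /mkset in e.
  rewrite -!supp1; split=> h; apply: contrapT => h'.
    by have := e.1 h'; apply.
  by have := e.2 h'; apply.
- by move=> P; apply: Spec_eq => r; apply: iff_sym; apply: GP.
- apply/continuousP => _ [S _ <-].
  rewrite (_ : _ @^-1` _ = \bigcup_(r in S) supp r); last first.
    apply/predeqP => y; split=> [|[r Sr ry] /(_ r Sr)/= //].
    move=> /= /existsNP[r /not_implyP[Sr /contrapT ry]].
    by exists r.
  apply: bigcup_open => r _; have [X XP] := suppP r.
  rewrite (_ : supp r =
    \bigcup_(C in [set` X]) [set y | [set` C] `<=` mem y]).
    by apply: bigcup_open => C _; apply: open_above.
  by apply/predeqP => y; rewrite XP; split=> -[C]; exists C.
- apply/continuousP => O Oop; rewrite openE => P /= /(open_base _ _ Oop)[C [Cy CO]].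
  rewrite /interior nbhsE; exists (~` zariski_closed [set f C]).
    split; first by exists [set f C].
    move=> /= /(_ (f C) erefl); rewrite GP; apply; exact/supp_f.
  move=> Q /= Qf; apply: CO => /=; apply/supp_f; apply: contrapT => nf.
  by apply: Qf => _ ->; rewrite GP.
Qed.

(** * Thick submodules *)

Section Submodules.
Variables (K : ttcat) (M : ttmodule K).
Implicit Types (N P : SMod M) (D : set (SMod M)) (m : M) (S : set M).

Lemma smod_eq N P : (N : set M) = P -> N = P.
Proof.
case: N P => [N tN] [P tP] /= NP; subst P.
by congr mkSMod; apply: Prop_irrelevance.
Qed.

Definition smod_span S : SMod M := mkSMod (thick_smallest S).

Lemma span_ext S : S `<=` smod_span S.
Proof. by move=> m Sm L [_]; apply. Qed.

Lemma span_min S N : S `<=` N -> smod_span S `<=` N.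
Proof. by move=> SN m; apply; split=> //; apply: smod_thick. Qed.

Lemma gen_mem m : (smod_gen m : set M) m.
Proof. exact: (span_ext (S := [set m])). Qed.

Lemma gen_min m N : (N : set M) m -> smod_gen m `<=` N.
Proof. by move=> Nm; apply: (@span_min [set m]) => _ ->. Qed.

Lemma thick_bigcap (I : Type) (J : set I) (F : I -> SMod M) :
  thick_submodule (\bigcap_(j in J) (F j : set M)).
Proof.
split.
- by move=> z z0 j _; apply: (thick_zero (smod_thick (F j))).
- by move=> a m Fm j Jj; apply: (thick_act (smod_thick (F j))); apply: Fm.
- move=> m m' s sP; split=> [Fs|[Fm Fm'] j Jj].
    by split=> j Jj; have [] := (thick_dsum (smod_thick (F j)) sP).1 (Fs j Jj).
  by apply/(thick_dsum (smod_thick (F j)) sP); split; [apply: Fm|apply: Fm'].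
- move=> m' m m'' f g h fgh; split=> F1 F2 j Jj;
    have [] := thick_dist (smod_thick (F j)) fgh;
    have := F1 j Jj; have := F2 j Jj; tauto.
Qed.

(** Each closure condition involves at most two given objects, which directedness places in one
    member of [D]; nonemptiness supplies the zero objects. *)
Lemma thick_directed_union D : filtered_directed D ->
  thick_submodule (\bigcup_(P in D) (P : set M)).
Proof.
move=> [[P0 DP0] Ddir].
have common m m' : (\bigcup_(P in D) (P : set M)) m ->
    (\bigcup_(P in D) (P : set M)) m' ->
    exists P, [/\ D P, (P : set M) m & (P : set M) m'].
  move=> [P DP Pm] [P' DP' Pm']; have [Q [DQ PQ P'Q]] := Ddir _ _ DP DP'.
  by exists Q; split; [|exact: PQ|exact: P'Q].
split.
- by move=> z z0; exists P0 => //; apply: (thick_zero (smod_thick P0)).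
- by move=> a m [P DP Pm]; exists P => //; apply: (thick_act (smod_thick P)).
- move=> m m' s sP; split=> [[P DP Ps]|[Pm Pm']].
    have [] := (thick_dsum (smod_thick P) sP).1 Ps.
    by split; exists P.
  have [P [DP {}Pm {}Pm']] := common _ _ Pm Pm'.
  by exists P => //; apply/(thick_dsum (smod_thick P) sP).
- move=> m' m m'' f g h fgh.
  by split=> P1 P2; have [P [DP {}P1 {}P2]] := common _ _ P1 P2; exists P => //;
    have [] := thick_dist (smod_thick P) fgh; tauto.
Qed.

Lemma Uopen_zero : exists z, Uopen z = setT :> set (SMod M).
Proof.
have [z z0] := tri_zero M; exists z; apply/predeqP => N; split=> // _.
exact: (thick_zero (smod_thick N)).
Qed.

Lemma Uopen_dsum m m' : exists s, Uopen s = Uopen m `&` Uopen m' :> set (SMod M).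
Proof.
have [s sP] := tri_dsum m m'; exists s; apply/predeqP => N.
exact: (thick_dsum (smod_thick N) sP).
Qed.

Lemma Uopen_open m : open (Uopen m : set (SMod M)).
Proof.
exists [set Uopen m]; last by rewrite bigcup_set1.
move=> _ ->; exists [fset (Uopen m : set (SMod M))]%fset.
  by move=> _ /fset1P ->; rewrite inE; exists m.
by rewrite set_fset1 bigcap_set1.
Qed.

(** Direct sums turn binary intersections of subbasic opens into subbasic opens, and a zero object
    gives the empty intersection. So the subbasis is already a basis. *)
Lemma Uopen_base (A : set (SMod M)) N : open A -> A N ->
  exists2 m, (N : set M) m & Uopen m `<=` A.
Proof.
move=> [B BI <-] [b Bb Nb]; have [E EU bE] := BI _ Bb.
suff [m mE] : exists m, Uopen m = \bigcap_(i in [set` E]) i.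
  exists m; first by have : Uopen m N by rewrite mE bE.
  by rewrite mE bE => P Pb; exists b.
have : {subset (E : seq (set (SMod M))) <= range (@Uopen K M)}.
  by move=> i; apply: EU.
rewrite bigcap_fset; elim: (E : seq _) => [_|a s IH sU].
  by have [z zE] := Uopen_zero; exists z; rewrite zE big_nil.
have [|m mE] := IH; first by move=> i is_; apply: sU; rewrite inE is_ orbT.
have /set_mem[m' _ m'E] := sU a (mem_head _ _).
have [d dE] := Uopen_dsum m' m; exists d.
by rewrite dE mE m'E big_cons.
Qed.

End Submodules.

(** * Fixed points of a closure operator of finite type *)

Section ClosureOperator.
Variables (K : ttcat) (M : ttmodule K) (c : SMod M -> SMod M).
Hypotheses (c_closure : closure_operator c) (c_finite : finite_type c).
Implicit Types (N P : SMod M) (m : M) (S : set M).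

Let c_ext N : N `<=` c N. Proof. by have [] := c_closure. Qed.
Let c_mono N P : N `<=` P -> c N `<=` c P.
Proof. by have [_ h _] := c_closure; apply: h. Qed.
Let c_idem N : c (c N) = c N. Proof. by have [] := c_closure. Qed.

Let A : set (SMod M) := [set N | c N = N].

Lemma fixed_of_sub N : c N `<=` N -> c N = N.
Proof. by move=> cN; apply: smod_eq; apply/seteqP; split. Qed.

Lemma fixed_bigcap (I : Type) (J : set I) (F : I -> SMod M) :
  (forall j, c (F j) = F j) ->
  exists2 N, c N = N & N = \bigcap_(j in J) (F j : set M) :> set M.
Proof.
move=> cF; exists (mkSMod (thick_bigcap J F)) => //.
apply: fixed_of_sub => m cm j Jj; rewrite -cF.
by apply: c_mono cm => n /(_ j Jj).
Qed.

(** Finite type reduces the closure of the union to closures of single generators, each lying in one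
    fixed member. *)
Lemma fixed_directed_union (D : set (SMod M)) :
  D `<=` A -> filtered_directed D ->
  exists2 N, c N = N & N = \bigcup_(P in D) (P : set M) :> set M.
Proof.
move=> DA Dd; exists (mkSMod (thick_directed_union Dd)) => //.
apply: fixed_of_sub => m; rewrite c_finite => -[n [P DP Pn] cm].
by exists P => //; rewrite -(DA _ DP); apply: c_mono cm; apply: gen_min.
Qed.

Definition fixed_hull S : set_type A :=
  exist _ (c (smod_span S)) (mem_set (c_idem (smod_span S))).

Lemma fixed_hull_ext S : S `<=` set_val (fixed_hull S).
Proof. by move=> m Sm; apply: c_ext; apply: span_ext. Qed.

Lemma fixed_hull_min S (y : set_type A) :
  S `<=` set_val y -> set_val (fixed_hull S) `<=` set_val y.
Proof.
case: y => N /[dup] /set_mem cN NA SN m cm.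
suff : (c N : set M) m by rewrite cN.
by apply: c_mono cm; apply: span_min.
Qed.

(** The spans of finite subsets of [S] form a directed family whose union is a submodule containing
    [S]. The type [{classic M}] provides the choice structure that finite sets of objects
    require. *)
Lemma span_finitary S m : (smod_span S : set M) m ->
  exists C : {fset {classic M}}, [set` C] `<=` S /\ (smod_span [set` C] : set M) m.
Proof.
pose s (C : {fset {classic M}}) : set M := [set` C].
pose D := [set smod_span (s C) | C in [set C : {fset {classic M}} | s C `<=` S]].
have Dd : filtered_directed D.
  split; first by exists (smod_span (s fset0)), fset0 => // i; rewrite /s /= inE.
  move=> _ _ [C CS <-] [C' C'S <-].
  exists (smod_span (s (C `|` C')%fset)); split.
  - exists (C `|` C')%fset => // i; rewrite /s /= inE => /orP[]; [exact: CS|exact: C'S].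
  - apply: span_min => i iC; apply: span_ext; rewrite /s /= inE; apply/orP; left; exact: iC.
  - apply: span_min => i iC; apply: span_ext; rewrite /s /= inE; apply/orP; right; exact: iC.
have sub : smod_span S `<=` mkSMod (thick_directed_union Dd).
  apply: span_min => i Si; exists (smod_span (s [fset (i : {classic M})]%fset)).
    by exists [fset (i : {classic M})]%fset => // j; rewrite /s /= inE => /eqP ->.
  by apply: span_ext; rewrite /s /= inE.
by move=> /sub[_ [C CS <-] Cm]; exists C.
Qed.

Lemma fixed_hull_finitary S m : (set_val (fixed_hull S) : set M) m ->
  exists C : {fset {classic M}},
    [set` C] `<=` S /\ (set_val (fixed_hull [set` C]) : set M) m.
Proof.
rewrite set_valE /= c_finite => -[n /span_finitary[C [CS Cn]] cm].
by exists C; split=> //; apply: c_mono cm; apply: gen_min.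
Qed.

Lemma Usub_open m : open (Usub A m).
Proof. by exists (Uopen m) => //; apply: Uopen_open. Qed.

Lemma Usub_base (O : set (set_type A)) y : open O -> O y ->
  exists2 m, (set_val y : set M) m & Usub A m `<=` O.
Proof.
move=> [B Bop <-] By; have [m ym mB] := Uopen_base Bop By.
by exists m => // z zm; apply: mB.
Qed.

Lemma Usub_basis : basis (range (Usub A)).
Proof.
split=> [_ [m _ <-]|y]; first exact: Usub_open.
move=> V; rewrite nbhsE => -[O [Oop Oy] OV].
have [m ym mO] := Usub_base Oop Oy.
exists (Usub A m); first by split=> //; exists m.
by apply: subset_trans OV.
Qed.

(* The hull of [m] is the least point of [Usub A m], and every neighbourhood of a
   point contains all larger points. *)
Lemma Usub_compact m : compact (Usub A m).
Proof.
move=> F FF Fm; pose y := fixed_hull [set m].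
have ym : Usub A m y by apply: (@fixed_hull_ext [set m]).
exists y; split=> // B V FB; rewrite nbhsE => -[O [Oop Oy] OV].
have [m' ym' m'O] := Usub_base Oop Oy.
have [z [Bz zm]] := filter_ex (filterI FB Fm).
exists z; split=> //; apply/OV/m'O.
by apply: (@fixed_hull_min [set m] z) ym' => _ ->.
Qed.

(** The fixed points are the closed sets of a finitary closure system on the objects of [M], with
    hull [c] of the span. *)
Lemma fixed_spectral : spectral_space (set_type A).
Proof.
apply: (@spectral_closure_system {classic M} (set_type A)
  (fun y => set_val y : set M) fixed_hull).
- by move=> y z /smod_eq /val_inj.
- exact: fixed_hull_ext.
- exact: fixed_hull_min.
- exact: fixed_hull_finitary.
- move=> C; rewrite (_ : mkset _ = \bigcap_(i in [set` C]) Usub A i).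
    rewrite bigcap_fset; elim/big_ind: _ => [||i _]; first exact: openT.
      exact: openI.
    exact: Usub_open.
  by apply/predeqP => y; split=> yC i /yC.
- move=> O y Oop Oy; have [m ym mO] := Usub_base Oop Oy.
  exists [fset (m : {classic M})]%fset; split.
    by move=> i; rewrite /= inE => /eqP ->.
  by move=> z zm; apply: mO; apply: zm; rewrite /= inE.
Qed.

End ClosureOperator.

(** * From a family to its closure operator, and the equivalence *)

Lemma exists_closure_operator (K : ttcat) (M : ttmodule K) (I : Type)
    (F : I -> SMod M) : range F (smod_full M) ->
  (forall J : set I, J !=set0 -> exists2 N : SMod M, range F N &
     N = \bigcap_(j in J) (F j : set M) :> set M) ->
  (forall D : set (SMod M), D `<=` range F -> filtered_directed D ->
     exists2 N : SMod M, range F N &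
       N = \bigcup_(P in D) (P : set M) :> set M) ->
  exists c : SMod M -> SMod M, [/\ closure_operator c, finite_type c
    & range F = [set N : SMod M | c N = N]].
Proof.
move=> [i0 _ Fi0] Fcap Fcup.
have /choice[c cP] : forall N : SMod M, exists P : SMod M,
    range F P /\ P = \bigcap_(j in [set j | N `<=` F j]) (F j : set M) :> set M.
  move=> N; have [|P FP PE] := Fcap [set j | N `<=` F j].
    (* The full submodule belongs to the family, so the intersection is over a nonempty set of
       indices. *)
    by exists i0; rewrite /= Fi0.
  by exists P.
have c_ext (N : SMod M) : N `<=` c N by move=> m Nm; rewrite (cP N).2 => j; apply.
have c_min (N P : SMod M) : range F P -> N `<=` P -> c N `<=` P.
  by move=> [j _ <-] Nj m; rewrite (cP N).2; apply.
have c_fix (P : SMod M) : range F P -> c P = P.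
  by move=> FP; apply: smod_eq; apply/seteqP; split=> //; apply: c_min.
have c_mono (N P : SMod M) : N `<=` P -> c N `<=` c P.
  by move=> NP; apply: c_min (cP P).1 _; apply: subset_trans NP _.
exists c; split.
- by split=> // N; apply/c_fix/(cP N).1.
- move=> N; apply/seteqP; split; last first.
    by move=> m [n Nn]; apply: c_mono; apply: gen_min.
  (* The union of [D] is a member of the family containing [N], so it contains [c N]. *)
  pose D := [set c (smod_gen n) | n in (N : set M)].
  have [||P FP PE] := Fcup D; first by move=> _ [n _ <-]; apply: (cP _).1.
    split.
      have [z z0] := tri_zero M; exists (c (smod_gen z)), z => //.
      exact: (thick_zero (smod_thick N)).
    (* The closure generated by a direct sum of [n] and [n'] contains those generated by either, and
       the sum still lies in [N]. *)
    move=> _ _ [n Nn <-] [n' Nn' <-]; have [s sE] := Uopen_dsum n n'.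
    have sP (Q : SMod M) : (Q : set M) s <-> (Q : set M) n /\ (Q : set M) n'.
      by move/predeqP: sE; apply.
    have [sn sn'] := (sP (smod_gen s)).1 (@gen_mem K M s).
    exists (c (smod_gen s)); split.
    + by exists s => //; apply/sP.
    + by apply: c_mono; apply: gen_min.
    + by apply: c_mono; apply: gen_min.
  have NP : N `<=` P.
    move=> n Nn; rewrite PE; exists (c (smod_gen n)); first by exists n.
    by apply: c_ext; exact: (@gen_mem K M n).
  move=> m /(c_min _ _ FP NP); rewrite PE => -[_ [n Nn <-] cm].
  by exists n.
- apply/seteqP; split=> [P /c_fix//|P <-]; exact: (cP P).1.
Qed.

Theorem proposition2p6 (K : ttcat) (M : ttmodule K) (I : Type)
    (F : I -> SMod M) (FM : range F (smod_full M)) :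
  (((forall J : set I, J !=set0 ->
       exists2 N : SMod M, range F N &
         N = \bigcap_(j in J) (F j : set M) :> set M)
    /\
    (forall D : set (SMod M), D `<=` range F -> filtered_directed D ->
       exists2 N : SMod M, range F N &
         N = \bigcup_(P in D) (P : set M) :> set M))
   <->
   (exists c : SMod M -> SMod M,
      [/\ closure_operator c, finite_type c
        & range F = [set N : SMod M | c N = N]]))
  /\
  (forall c : SMod M -> SMod M,
     closure_operator c -> finite_type c ->
     range F = [set N : SMod M | c N = N] ->
     [/\ spectral_space (set_type (range F)),
         basis (range (Usub (range F)))
       & forall m : M, open (Usub (range F) m) /\ compact (Usub (range F) m)]).
Proof.
split; [split=> [[Fcap Fcup]|[c [c_closure c_finite FE]]]|].
- exact: exists_closure_operator.
- split=> [J _|D DF Dd]; rewrite FE.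
    apply: fixed_bigcap => // j.
    by have : range F (F j) by []; rewrite FE.
  by apply: fixed_directed_union => //; rewrite -FE.
- move=> c c_closure c_finite ->; split.
  + exact: fixed_spectral.
  + exact: Usub_basis.
  + by move=> m; split; [exact: Usub_open|exact: Usub_compact].
Qed.
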